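(* Let $X$ be a Banach space with a conditional spreading basis $(e_i)_i$ and let $(z_i)_i$ be its convex block homogeneous part. Every seminormalized block sequence $(x_i)_i$ of $(e_i)_i$ in $X$ either has an unconditional subsequence or it has a convex block sequence that is equivalent to $(z_i)_i$.
   Context: Banach spaces are real. Two sequences are equivalent if the norms of their finite linear combinations with the same coefficients are comparable up to uniform positive constants. A sequence is spreading (resp. 1-spreading) if it is equivalent (resp. isometrically equivalent) to all of its subsequences. A conditional spreading basis is a Schauder basis that is spreading and not unconditional. A convex block sequence of $(x_i)_i$ is a sequence $(w_k)_k$ with $w_k=\sum_{i\in F_k}c_ix_i$, where $F_1<F_2<\cdots$ are successive finite subsets of $\mathbb{N}$, $c_i\geqslant0$ and $\sum_{i\in F_k}c_i=1$. Convex block homogeneous part: let $(e_i)_i$ be a conditional spreading basis of $X$. After passing to an equivalent norm on $X$ with respect to which $(e_i)_i$ is 1-spreading (such a norm exists), let $Z$ be the completion of $c_{00}(\mathbb{N})$, with unit vector basis denoted $(z_i)_i$, under the norm $$\Big\|\sum_{i=1}^na_iz_i\Big\|=\lim_{N\to\infty}\Big\|\sum_{i=1}^na_i\Big(\frac1N\sum_{j=(i-1)N+1}^{iN}e_j\Big)\Big\|=\inf\Big\{\Big\|\sum_{i=1}^na_iw_i\Big\|:(w_i)_{i=1}^n\text{ is a convex block sequence of }(e_i)_i\Big\}.$$ The sequence $(z_i)_i$, which is well defined up to equivalence, is the convex block homogeneous part of $(e_i)_i$. *)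

(* Defs.v *)
From HB Require Import structures.
From mathcomp Require Import all_boot all_order all_algebra finmap.
From mathcomp Require Import all_classical all_reals all_analysis.
Import Order.TTheory GRing.Theory Num.Theory numFieldNormedType.Exports.

Set Implicit Arguments.
Unset Strict Implicit.
Unset Printing Implicit Defensive.

Local Open Scope classical_set_scope.
Local Open Scope ring_scope.

(* Sequences are indexed from 0. *)

Definition lincomb (R : realType) (X : normedModType R)
    (x : nat -> X) (n : nat) (a : nat -> R) : X :=
  \sum_(i < n) a i *: x i.

Definition closed_span (R : realType) (X : normedModType R) (x : nat -> X) :
    set X :=
  closure [set v | exists (n : nat) (a : nat -> R), v = lincomb x n a].

Definition expands (R : realType) (X : normedModType R)
    (x : nat -> X) (v : X) (a : nat -> R) : Prop :=
  series (fun i => a i *: x i) @ \oo --> v.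

Definition schauder_basis (R : realType) (X : normedModType R)
    (e : nat -> X) : Prop :=
  forall v : X, exists! a : nat -> R, expands e v a.

Definition basic_seq (R : realType) (X : normedModType R)
    (x : nat -> X) : Prop :=
  forall v : X, closed_span x v -> exists! a : nat -> R, expands x v a.

Definition unconditional (R : realType) (X : normedModType R)
    (x : nat -> X) : Prop :=
  basic_seq x /\
  exists C : R, forall (n : nat) (a : nat -> R) (s : nat -> bool),
    `|lincomb x n (fun i => (-1) ^+ s i * a i)| <= C * `|lincomb x n a|.

Definition equivalent_seq (R : realType) (X Y : normedModType R)
    (x : nat -> X) (y : nat -> Y) : Prop :=
  exists c C : R, [/\ 0 < c, 0 < C & forall (n : nat) (a : nat -> R),
    c * `|lincomb x n a| <= `|lincomb y n a| <= C * `|lincomb x n a| ].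

Definition strictly_increasing (phi : nat -> nat) : Prop :=
  {homo phi : m n / (m < n)%N}.

Definition spreading (R : realType) (X : normedModType R)
    (x : nat -> X) : Prop :=
  forall phi : nat -> nat, strictly_increasing phi ->
    equivalent_seq x (x \o phi).

Definition conditional_spreading_basis (R : realType) (X : normedModType R)
    (e : nat -> X) : Prop :=
  [/\ schauder_basis e, spreading e & ~ unconditional e].

Definition seminormalized (R : realType) (X : normedModType R)
    (x : nat -> X) : Prop :=
  exists c C : R, 0 < c /\ forall k : nat, c <= `|x k| <= C.

Definition successive (F : nat -> {fset nat}) : Prop :=
  forall k l i j : nat, (k < l)%N -> i \in F k -> j \in F l -> (i < j)%N.

(* Since the F k are disjoint, one coefficient sequence serves all blocks. *)
Definition block_seq (R : realType) (X : normedModType R)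
    (x w : nat -> X) : Prop :=
  exists (F : nat -> {fset nat}) (c : nat -> R), successive F /\
    forall k : nat, w k = \sum_(i <- F k) c i *: x i.

Definition convex_block_seq (R : realType) (X : normedModType R)
    (x w : nat -> X) : Prop :=
  exists (F : nat -> {fset nat}) (c : nat -> R), successive F /\
    forall k : nat,
      [/\ forall i : nat, i \in F k -> 0 <= c i,
          \sum_(i <- F k) c i = 1
        & w k = \sum_(i <- F k) c i *: x i].

(* Definiteness of N follows from the lower estimate. *)
Definition equivalent_norm (R : realType) (X : normedModType R)
    (N : X -> R) : Prop :=
  [/\ forall u v : X, N (u + v) <= N u + N v,
      forall (a : R) (v : X), N (a *: v) = `|a| * N v
    & exists c C : R, [/\ 0 < c, 0 < C &
        forall v : X, c * `|v| <= N v <= C * `|v| ]].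

Definition one_spreading (R : realType) (X : normedModType R)
    (N : X -> R) (x : nat -> X) : Prop :=
  forall phi : nat -> nat, strictly_increasing phi ->
    forall (n : nat) (a : nat -> R),
      N (lincomb (x \o phi) n a) = N (lincomb x n a).

(* The i-th consecutive average of length m; at m = 0 it is 0, which is
   irrelevant in the limit m -> oo. *)
Definition average (R : realType) (X : normedModType R)
    (e : nat -> X) (m i : nat) : X :=
  m%:R^-1 *: \sum_(i * m <= j < i.+1 * m) e j.

(* z is the unit vector basis of the completion of c_00 under the limit norm,
   for some choice of the renorming N of X: the completion is characterized,
   up to isometry, as a Banach space Z in which the span of z is dense and the
   norm on that span is the prescribed one. The equality of the limit with the
   infimum over the convex block sequences of e is not assumed. *)
Definition convex_block_homogeneous_part (R : realType)
    (X Z : completeNormedModType R) (e : nat -> X) (z : nat -> Z) : Prop :=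
  exists N : X -> R,
    [/\ equivalent_norm N,
        one_spreading N e,
        closed_span z = setT
      & forall (n : nat) (a : nat -> R),
          (fun m : nat => N (lincomb (average e m) n a)) @ \oo
            --> `|lincomb z n a| ].

(* Main.v *)
Require Import Defs.
From mathcomp Require Import all_boot all_order all_algebra.
From mathcomp Require Import all_classical all_reals all_analysis.
From mathcomp Require Import finmap zify ring lra.
Import Order.TTheory GRing.Theory Num.Theory numFieldNormedType.Exports.

Set Implicit Arguments.
Unset Strict Implicit.
Unset Printing Implicit Defensive.

Local Open Scope classical_set_scope.
Local Open Scope ring_scope.

(** A 1-spreading norm N is fixed. Translating a zero-sum block along the basis
    and averaging over the translates makes the block disappear, so successive
    zero-sum blocks are unconditional. If the summing functional were unbounded,
    or if the averages of the differences e_{2k} - e_{2k+1} did not tend to 0,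
    this would make (e_i) itself unconditional; if the partial sums of the
    coefficients were unbounded, the averages of (e_i) would converge to a
    shift-invariant vector, contradicting the uniqueness of expansions. Hence a
    combination of the e_i of l1-norm 1 whose coefficients have uniformly small
    partial sums is small in norm.

    Let s_j be the coefficient sum of x_j, y_j = x_j - s_j e_{m_j} with m_j next
    to the support of x_j, and let s be a cluster point of (s_j). If s = 0, a
    subsequence of (x_j) is a small perturbation of the unconditional sequence
    (y_j). If s <> 0 and no subsequence is unconditional, then no tail of a
    subsequence with s_j -> s dominates l1: there are signed combinations of
    l1-norm 1 and small norm. Their coefficients a_j have small partial sums, so
    sum a_j y_j and hence sum |a_j| y_j are small. Thus the convex blocks
    w_k = sum |a_j| x_j are close to s times convex blocks g_k of (e_i) with
    small coefficients; such g_k are norm close to long averages spread over the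
    same region, so (g_k) is equivalent to (z_k). *)

(** * Spreading seminorms *)

Definition increasing_below (n : nat) (phi : nat -> nat) :=
  forall i j : nat, (i < j)%N -> (j < n)%N -> (phi i < phi j)%N.

Lemma strictly_increasing_below (n : nat) (phi : nat -> nat) :
  strictly_increasing phi -> increasing_below n phi.
Proof. by move=> h i j ij _; apply: h. Qed.

Lemma leq_strictly_increasing (phi : nat -> nat) (i j : nat) :
  strictly_increasing phi -> (i <= j)%N -> (phi i <= phi j)%N.
Proof.
move=> h; rewrite leq_eqVlt => /orP[/eqP -> //|/h]; exact: ltnW.
Qed.

Section Seminorm.
Context (R : realType) (X : normedModType R) (N : X -> R).
Hypothesis N_add : forall u v : X, N (u + v) <= N u + N v.
Hypothesis N_scale : forall (a : R) (v : X), N (a *: v) = `|a| * N v.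

Lemma seminorm0 : N 0 = 0.
Proof. by rewrite -(scale0r 0) N_scale normr0 mul0r. Qed.

Lemma seminormN (v : X) : N (- v) = N v.
Proof. by rewrite -scaleN1r N_scale normrN1 mul1r. Qed.

Lemma seminorm_ge0 (v : X) : 0 <= N v.
Proof. by have := N_add v (- v); rewrite subrr seminorm0 seminormN; lra. Qed.

Lemma seminormB (u v : X) : N (u - v) <= N u + N v.
Proof. by rewrite -(seminormN v). Qed.

Lemma seminorm_distC (u v : X) : N (u - v) = N (v - u).
Proof. by rewrite -seminormN opprB. Qed.

Lemma seminorm_le_dist (u v : X) : N u <= N v + N (u - v).
Proof. by rewrite -{1}(subrK v u) addrC; apply: N_add. Qed.

Lemma seminorm_sum (I : Type) (r : seq I) (P : pred I) (F : I -> X) :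
  N (\sum_(i <- r | P i) F i) <= \sum_(i <- r | P i) N (F i).
Proof.
elim/big_ind2 : _ => // [|x1 x2 y1 y2 h1 h2]; first by rewrite seminorm0.
by apply: le_trans (N_add _ _) _; apply: lerD.
Qed.

(** A shift by one place telescopes: it changes the sum by its two end terms only, hence by at most
    [2 * b]. This is iterated [i] times. *)
Lemma seminorm_translate (f : nat -> X) (b : R) (P i : nat) :
  (forall j, N (f j) <= b) ->
  N (\sum_(t < P) f (i + t)%N - \sum_(t < P) f t) <= i%:R * (2 * b).
Proof.
move=> hb; elim: i => [|i ih]; first by rewrite subrr seminorm0 mul0r.
have tele : \sum_(t < P) f (i.+1 + t)%N - \sum_(t < P) f (i + t)%N
    = f (i + P)%N - f i.
  elim: P {ih} => [|P ih]; first by rewrite !big_ord0 addn0 !subrr.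
  rewrite !big_ord_recr /= addnS addSn opprD addrACA ih.
  by rewrite addrC addrA subrK.
rewrite -(subrK (\sum_(t < P) f (i + t)%N) (\sum_(t < P) f (i.+1 + t)%N)).
rewrite tele -addrA; apply: le_trans (N_add _ _) _.
have := hb i; have := hb (i + P)%N; have := seminormB (f (i + P)%N) (f i).
rewrite -natr1; lra.
Qed.

(* The average over t < P of the translated block only differs from a multiple
   of the plain average by edge effects. *)
Lemma seminorm_translate_average (f : nat -> X) (b : R) (n : nat)
    (c : nat -> R) (W : X) (M : R) (P : nat) :
  (forall j, N (f j) <= b) -> (0 < P)%N ->
  (forall t, (t < P)%N -> N (W + \sum_(i < n) c i *: f (i + t)%N) <= M) ->
  N (W + (\sum_(i < n) c i) *: (P%:R^-1 *: \sum_(t < P) f t))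
    <= M + (\sum_(i < n) `|c i| * (i%:R * (2 * b))) / P%:R.
Proof.
move=> hb P0 hM; have P0' : 0 < P%:R :> R by rewrite ltr0n.
pose A := \sum_(t < P) (W + \sum_(i < n) c i *: f (i + t)%N).
pose B := \sum_(i < n) c i *: (\sum_(t < P) f (i + t)%N - \sum_(t < P) f t).
have -> : W + (\sum_(i < n) c i) *: (P%:R^-1 *: \sum_(t < P) f t)
    = P%:R^-1 *: A - P%:R^-1 *: B.
  have hA : A = P%:R *: W + \sum_(i < n) c i *: \sum_(t < P) f (i + t)%N.
    rewrite /A big_split /= sumr_const card_ord exchange_big scaler_nat.
    by congr (_ + _); apply: eq_bigr => i _; rewrite scaler_sumr.
  have hB : B = \sum_(i < n) c i *: \sum_(t < P) f (i + t)%N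
      - (\sum_(i < n) c i) *: \sum_(t < P) f t.
    by rewrite /B scaler_suml -sumrB; apply: eq_bigr => i _; rewrite scalerBr.
  rewrite -scalerBr hA hB opprB -addrA subrKC.
  by rewrite scalerDr !scalerA mulVf ?gt_eqF // scale1r mulrC.
apply: le_trans (seminormB _ _) _; rewrite !N_scale gtr0_norm ?invr_gt0 //.
apply: lerD.
- rewrite ler_pdivrMl //; apply: le_trans (seminorm_sum _ _ _) _.
  apply: (@le_trans _ _ (\sum_(t < P) M)).
    by apply: ler_sum => t _; apply: hM.
  by rewrite sumr_const card_ord mulr_natl.
- rewrite mulrC ler_wpM2r ?invr_ge0 ?(ltW P0') //.
  apply: le_trans (seminorm_sum _ _ _) _; apply: ler_sum => i _.
  by rewrite N_scale ler_wpM2l //; apply: seminorm_translate.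
Qed.

(** Removes the edge effects of an average of length [P] by letting [P] tend to infinity. *)
Lemma seminorm_const_le (M K v : R) :
  (forall P : nat, (0 < P)%N -> v <= M + K / P%:R) -> v <= M.
Proof.
move=> h; apply/ler_addgt0Pr => eps e0.
pose P := (Num.truncn (`|K| / eps)).+1.
have P0 : 0 < P%:R :> R by rewrite ltr0n.
apply: le_trans (h P isT) _; rewrite lerD2l ler_pdivrMr //.
have : `|K| / eps < P%:R by apply: truncnS_gt.
rewrite ltr_pdivrMr // mulrC => hK.
by apply: le_trans (ler_norm K) (ltW hK).
Qed.

Section Spreading.
Context (e : nat -> X).
Hypothesis e_spreading : one_spreading N e.

Lemma spread_below (n : nat) (phi : nat -> nat) (a : nat -> R) :
  increasing_below n phi ->
  N (\sum_(i < n) a i *: e (phi i)) = N (lincomb e n a).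
Proof.
move=> hphi.
(* [one_spreading] speaks of globally increasing maps. Past [n], adding the sum of all earlier
   values of [phi] puts [psi] above each of them. *)
pose psi i := if (i < n)%N then phi i else (\sum_(j < n) phi j + i.+1)%N.
have psi_inc : strictly_increasing psi.
  move=> i j ij; rewrite /psi; case: (ltnP j n) => jn.
    by rewrite (ltn_trans ij jn) hphi.
  case: (ltnP i n) => i_n; last by rewrite ltn_add2l.
  by rewrite (bigD1 (Ordinal i_n)) //=; lia.
rewrite -(e_spreading psi_inc n a) /lincomb; congr N; apply: eq_bigr => i _.
by rewrite /psi /= ltn_ord.
Qed.

Lemma spread_below_eq (n : nat) (phi psi : nat -> nat) (a : nat -> R) :
  increasing_below n phi -> increasing_below n psi ->
  N (\sum_(i < n) a i *: e (phi i)) = N (\sum_(i < n) a i *: e (psi i)).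
Proof. by move=> h1 h2; rewrite !spread_below. Qed.

Lemma spreading_norm (i : nat) : N (e i) = N (e 0%N).
Proof.
have h (k : nat) : increasing_below 1 (fun _ => k) by move=> ? [].
have := spread_below_eq (fun _ => 1) (h i) (h 0%N).
by rewrite !big_ord_recl !big_ord0 !addr0 !scale1r.
Qed.

Lemma lincomb_le_mass (n : nat) (phi : nat -> nat) (a : nat -> R) :
  N (\sum_(i < n) a i *: e (phi i)) <= (\sum_(i < n) `|a i|) * N (e 0%N).
Proof.
apply: le_trans (seminorm_sum _ _ _) _; rewrite mulr_suml.
by apply: ler_sum => i _; rewrite N_scale spreading_norm.
Qed.

(** Blocks are the classes of a monotone labelling. The class [k] can slide along the basis without
    changing the norm; the mean over [P] such translates is, up to an error of order [1 / P], the
    coefficient sum of the class times a fixed average, and this sum is 0. *)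
Lemma suppress_block (kap : nat -> nat) (n : nat) (a : nat -> R) (k : nat) :
  {homo kap : i j / (i <= j)%N} -> \sum_(i < n | kap i == k) a i = 0 ->
  N (lincomb e n (fun i => if kap i == k then 0 else a i))
    <= N (lincomb e n a).
Proof.
move=> kap_mono a0.
pose b i := if kap i == k then 0 else a i.
pose c i := if kap i == k then a i else 0.
apply: (@seminorm_const_le _
  (\sum_(i < n) `|c i| * (i%:R * (2 * N (e 0%N))))) => P P0.
(* Later classes move by [P] and earlier ones stay, which leaves the class [k] room for every shift
   up to [P]. *)
pose phi t i := (i + (if kap i == k then t else if (k < kap i)%N then P else 0))%N.
have phi_inc t : (t <= P)%N -> strictly_increasing (phi t).
  move=> tP i j ij; have := kap_mono _ _ (ltnW ij); rewrite /phi.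
  case: (kap i =P k) => ?; case: (kap j =P k) => ?; case: (ltnP k (kap i)) => ?;
    case: (ltnP k (kap j)) => ?; lia.
have c0 : \sum_(i < n) c i = 0.
  by rewrite /c -big_mkcond.
pose W := \sum_(i < n) b i *: e (phi P i).
have -> : N (lincomb e n b) = N (W + (\sum_(i < n) c i) *:
    (P%:R^-1 *: \sum_(t < P) e t)).
  by rewrite c0 scale0r addr0 /W spread_below //; apply/strictly_increasing_below/phi_inc.
apply: seminorm_translate_average => // [j|t tP].
  by rewrite spreading_norm.
have inc : increasing_below n (phi t).
  by apply/strictly_increasing_below/phi_inc/ltnW.
rewrite -(spread_below a inc).
rewrite le_eqVlt; apply/orP; left; apply/eqP; congr N.
rewrite /W -big_split; apply: eq_bigr => i _; rewrite /b /c /phi /=.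
by case: eqP => _; rewrite scale0r ?add0r ?addr0.
Qed.

Lemma suppress_blocks (kap : nat -> nat) (n : nat) (a : nat -> R)
    (T : pred nat) (K : nat) :
  {homo kap : i j / (i <= j)%N} ->
  (forall k, (k < K)%N -> T k -> \sum_(i < n | kap i == k) a i = 0) ->
  N (lincomb e n (fun i => if T (kap i) && (kap i < K)%N then 0 else a i))
    <= N (lincomb e n a).
Proof.
move=> kap_mono; elim: K => [|K ih] h.
  rewrite le_eqVlt; apply/orP; left; apply/eqP; congr N.
  by apply: eq_bigr => i _; rewrite ltn0 andbF.
apply: le_trans (ih (fun k kK => h k (ltnW kK))).
pose b i := if T (kap i) && (kap i < K)%N then 0 else a i.
case TK: (T K); last first.
  rewrite le_eqVlt; apply/orP; left; apply/eqP; congr N.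
  apply: eq_bigr => i _; rewrite ltnS leq_eqVlt.
  by case: eqP => //= ->; rewrite TK.
have b0 : \sum_(i < n | kap i == K) b i = 0.
  rewrite -[RHS](h K (ltnSn K) TK); apply: eq_bigr => i /eqP iK.
  by rewrite /b iK ltnn andbF.
apply: le_trans (suppress_block kap_mono b0).
rewrite le_eqVlt; apply/orP; left; apply/eqP; congr N.
apply: eq_bigr => i _; rewrite /b ltnS leq_eqVlt.
by case: eqP => //= ->; rewrite TK.
Qed.

Lemma suppress_labels (kap : nat -> nat) (n : nat) (a : nat -> R) (T : pred nat) :
  {homo kap : i j / (i <= j)%N} ->
  (forall k, T k -> \sum_(i < n | kap i == k) a i = 0) ->
  N (lincomb e n (fun i => if T (kap i) then 0 else a i)) <= N (lincomb e n a).
Proof.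
move=> kap_mono h.
apply: le_trans (suppress_blocks (K := (kap n).+1) kap_mono (fun k _ => h k)).
rewrite le_eqVlt; apply/orP; left; apply/eqP; congr N.
by apply: eq_bigr => i _; rewrite ltnS kap_mono ?andbT // ltnW.
Qed.

(** The signed combination is the difference of the two combinations that remain after removing the
    classes of one sign; each removal does not increase the norm. *)
Lemma sign_blocks (kap : nat -> nat) (n : nat) (a : nat -> R)
    (s : nat -> bool) :
  {homo kap : i j / (i <= j)%N} ->
  (forall k, \sum_(i < n | kap i == k) a i = 0) ->
  N (lincomb e n (fun i => (-1) ^+ s (kap i) * a i)) <= 2 * N (lincomb e n a).
Proof.
move=> kap_mono h.
have h1 := suppress_labels (T := s) kap_mono (fun k _ => h k).
have h2 := suppress_labels (T := predC s) kap_mono (fun k _ => h k).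
rewrite [2 * _]mulr_natl mulr2n; apply: le_trans (lerD h1 h2).
apply: le_trans (seminormB _ _); rewrite le_eqVlt; apply/orP; left; apply/eqP.
congr N; rewrite /lincomb -sumrB; apply: eq_bigr => i _ /=.
by case: (s (kap i)) => /=; rewrite ?expr1 ?expr0 -scalerBl ?sub0r ?subr0 ?mulN1r ?mul1r.
Qed.

End Spreading.
End Seminorm.

(** * Sign inequalities and unconditional basic sequences *)

Lemma cvg_seqP (R : realType) (V : normedModType R) (u : nat -> V) (l : V) :
  u @ \oo --> l <->
  forall eps : R, 0 < eps ->
    exists n0, forall n, (n0 <= n)%N -> `|u n - l| < eps.
Proof.
split.
- move=> /cvgrPdist_lt h eps e0; have [n0 _ hn0] := h _ e0.
  by exists n0 => n nn0; rewrite distrC; apply: hn0.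
- move=> h; apply/cvgrPdist_lt => eps e0; have [n0 hn0] := h _ e0.
  by exists n0 => // n /= nn0; rewrite distrC; apply: hn0.
Qed.

Lemma cauchy_seq_cvg (R : realType) (V : completeNormedModType R)
    (u : nat -> V) :
  (forall eps : R, 0 < eps -> exists n0, forall m n, (n0 <= m)%N -> (n0 <= n)%N ->
     `|u m - u n| < eps) ->
  exists l : V, u @ \oo --> l.
Proof.
move=> h; suff : cvg (u @ \oo) by move=> ?; exists (lim (u @ \oo)).
apply/cauchy_cvgP/cauchy_exP => eps e0; have [n0 hn0] := h _ e0.
exists (u n0); exists n0 => // n /= hn.
by rewrite -ball_normE /=; apply: hn0.
Qed.

Lemma series_lincomb (R : realType) (V : normedModType R) (x : nat -> V)
    (a : nat -> R) :
  series (fun i => a i *: x i) = fun n => lincomb x n a.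
Proof. by apply/funext => n; rewrite /series /= big_mkord. Qed.

Lemma inv_natS_lt (R : realType) (eps : R) : 0 < eps ->
  exists n0, forall n, (n0 <= n)%N -> n.+1%:R^-1 < eps.
Proof.
move=> e0; exists (Num.truncn eps^-1) => n hn.
rewrite invf_plt ?posrE ?ltr0n //; apply: lt_le_trans (truncnS_gt _) _.
by rewrite ler_nat ltnS.
Qed.

Lemma lincombB (R : realType) (V : normedModType R) (x : nat -> V) n
    (a b : nat -> R) :
  lincomb x n a - lincomb x n b = lincomb x n (fun i => a i - b i).
Proof. by rewrite /lincomb -sumrB; apply: eq_bigr => i _; rewrite scalerBl. Qed.

Lemma lincombS (R : realType) (V : normedModType R) (x : nat -> V) n
    (a : nat -> R) :
  lincomb x n.+1 a = lincomb x n a + a n *: x n.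
Proof. by rewrite /lincomb big_ord_recr. Qed.

Lemma lincomb_pad (R : realType) (V : normedModType R) (x : nat -> V) n m
    (a : nat -> R) : (n <= m)%N ->
  lincomb x m (fun i => if (i < n)%N then a i else 0) = lincomb x n a.
Proof.
move=> nm; rewrite /lincomb (big_ord_widen _ (fun i => a i *: x i) nm).
by rewrite [RHS]big_mkcond /=; apply: eq_bigr => i _; case: ifP; rewrite ?scale0r.
Qed.

Section SignInequality.
Context (R : realType) (X : normedModType R) (x : nat -> X) (c C : R).
Hypothesis c_gt0 : 0 < c.
Hypothesis x_ge : forall k, c <= `|x k|.
Hypothesis x_sign : forall n (a : nat -> R) (s : nat -> bool),
  `|lincomb x n (fun i => (-1) ^+ s i * a i)| <= C * `|lincomb x n a|.

Let B : R := 1 + `|C|.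

Let B_gt0 : 0 < B. Proof. by rewrite /B ltr_pwDl. Qed.

(** Restricting to [T] is the mean of the identity and of a change of signs. The constant [B] uses
    the absolute value of [C] so that it is positive whatever the sign of [C]. *)
Lemma sign_suppress n (a : nat -> R) (T : pred nat) :
  `|lincomb x n (fun i => if T i then a i else 0)| <= B * `|lincomb x n a|.
Proof.
have := x_sign n a (fun i => ~~ T i).
set u := lincomb x n _ => hu; set v := lincomb x n _.
have -> : v = 2^-1 *: (lincomb x n a + u).
  rewrite /v /u /lincomb -big_split scaler_sumr; apply: eq_bigr => i _ /=.
  rewrite -scalerDl scalerA; case: (T i) => /=; congr (_ *: _).
    by rewrite expr0; lra.
  by rewrite expr1; lra.
rewrite normrZ ger0_norm ?invr_ge0 //.
have := ler_normD (lincomb x n a) u.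
have : C * `|lincomb x n a| <= `|C| * `|lincomb x n a|.
  by rewrite ler_wpM2r // ler_norm.
have : 0 <= `|C| * `|lincomb x n a| by rewrite mulr_ge0.
have := normr_ge0 (lincomb x n a).
rewrite /B; lra.
Qed.

Lemma sign_partial m n (a : nat -> R) : (m <= n)%N ->
  `|lincomb x m a| <= B * `|lincomb x n a|.
Proof.
move=> mn; rewrite -(lincomb_pad x a mn).
exact: (sign_suppress n a (fun i => i < m)%N).
Qed.

Lemma sign_coef k n (a : nat -> R) : (k < n)%N ->
  c * `|a k| <= B * `|lincomb x n a|.
Proof.
move=> kn; apply: le_trans (sign_suppress n a (pred1 k)).
rewrite /lincomb (bigD1 (Ordinal kn)) //= eqxx big1 => [|i].
  by rewrite addr0 normrZ mulrC ler_wpM2l.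
by rewrite -val_eqE /= => /negbTE ->; rewrite scale0r.
Qed.

(** The partial sums and the coefficients are uniformly controlled by the norm, so finite
    combinations converging to [v] have coefficients that converge one by one, and the limits expand
    [v]. *)
Lemma sign_unconditional : unconditional x.
Proof.
split; last by exists C.
move=> v hv.
have /choice[p hp] (i : nat) : exists p : nat * (nat -> R),
    `|v - lincomb x p.1 p.2| < i.+1%:R^-1.
  have i0 : 0 < i.+1%:R^-1 :> R by rewrite invr_gt0 ltr0n.
  have [_ [[n [a ->]] hn]] := hv _ (nbhsx_ballx v _ i0).
  by exists (n, a); move: hn; rewrite -ball_normE.
(* Padding by 0 lets two approximations be compared at any common length. *)
pose b i k := if (k < (p i).1)%N then (p i).2 k else 0.
have hb i m : ((p i).1 <= m)%N -> `|v - lincomb x m (b i)| < i.+1%:R^-1.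
  by move=> hm; rewrite lincomb_pad.
have hd i j m : `|lincomb x m (b i) - lincomb x m (b j)| <=
    B * (i.+1%:R^-1 + j.+1%:R^-1).
  pose M := maxn m (maxn (p i).1 (p j).1).
  rewrite lincombB; apply: le_trans (sign_partial _ (leq_maxl _ _ : (m <= M)%N)) _.
  rewrite ler_wpM2l ?(ltW B_gt0) // -lincombB.
  have := hb i M; have := hb j M; rewrite /M !leq_max !leqnn !orbT.
  move=> /(_ isT) h1 /(_ isT) h2.
  rewrite (_ : _ - _ = (v - lincomb x M (b j)) - (v - lincomb x M (b i))); last first.
    by rewrite opprB [RHS]addrC addrA subrK.
  by apply: le_trans (ler_normB _ _) _; rewrite addrC lerD // ltW.
have /choice[d hd_cvg] k : exists d : R, b ^~ k @ \oo --> d.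
  apply: (@cauchy_seq_cvg R R) => eps e0.
  have e1 : 0 < c * eps / (2 * B * B) by rewrite divr_gt0 ?mulr_gt0.
  have [n0 hn0] := inv_natS_lt e1; exists n0 => i j hi hj.
  rewrite -(ltr_pM2l c_gt0).
  have := hd i j (maxn k.+1 (maxn (p i).1 (p j).1)); rewrite lincombB.
  move=> h; have : c * `|b i k - b j k| <= B * (B * (i.+1%:R^-1 + j.+1%:R^-1)).
    have h' := @sign_coef k _ (fun k => b i k - b j k)
      (leq_maxl _ (maxn (p i).1 (p j).1)).
    by apply: le_trans h' _; rewrite ler_pM2l.
  move: (hn0 _ hi) (hn0 _ hj) => h1 h2.
  have eqB : c * eps = B * (B * (c * eps / (2 * B * B) + c * eps / (2 * B * B))).
    by field; rewrite gt_eqF.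
  move=> h3; apply: le_lt_trans h3 _; rewrite eqB !ltr_pM2l //; exact: ltrD.
have lincomb_cvg m : (fun i => lincomb x m (b i)) @ \oo --> lincomb x m d.
  elim: m => [|m ih].
    by rewrite /lincomb big_ord0; under eq_fun do rewrite big_ord0; apply: cvg_cst.
  under eq_fun do rewrite lincombS; rewrite lincombS.
  by apply: cvgD => //; apply: cvgZr_tmp; apply: hd_cvg.
have hbd i m : `|lincomb x m (b i) - lincomb x m d| <= B * i.+1%:R^-1.
  apply/ler_addgt0Pr => eps e0.
  have e1 : 0 < eps / 2 by lra.
  have [j1 hj1] := (cvg_seqP _ _).1 (lincomb_cvg m) _ e1.
  have [j2 hj2] := inv_natS_lt (divr_gt0 e1 B_gt0).
  pose j := maxn j1 j2.
  have h1 := hj1 j (leq_maxl _ _); have h2 := hj2 j (leq_maxr _ _).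
  have h3 := hd i j m.
  have h4 := ler_distD (lincomb x m (b j)) (lincomb x m (b i)) (lincomb x m d).
  rewrite ltr_pdivlMr // [_ * B]mulrC in h2; rewrite mulrDr in h3.
  rewrite /= -/j in h1; rewrite -/j in h2.
  move: (i.+1%:R^-1) (j.+1%:R^-1) h2 h3 => ii jj h2 h3; lra.
have d_exp : expands x v d.
  rewrite /expands series_lincomb; apply/cvg_seqP => eps e0.
  have e1 : 0 < eps / (1 + B) by rewrite divr_gt0 // (addr_gt0 ltr01 B_gt0).
  have [i hi] := inv_natS_lt e1; exists (p i).1 => n hn.
  have := hb i n hn; have := hbd i n; have := hi i (leqnn i).
  rewrite ltr_pdivlMr ?(addr_gt0 ltr01 B_gt0) //.
  move: (i.+1%:R^-1) => ii h1 h2 h3.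
  have := ler_distD (lincomb x n (b i)) (lincomb x n d) v.
  rewrite (distrC (lincomb x n d) (lincomb x n (b i))).
  rewrite (distrC (lincomb x n (b i)) v); lra.
(* Uniqueness: the difference of two expansions has partial sums tending to 0, and these dominate
   each of its coefficients. *)
exists d; split => // d' d'_exp; apply/funext => k; apply/eqP.
rewrite -subr_eq0 -normr_eq0 eq_le normr_ge0 andbT leNgt; apply/negP => h0.
have d0 : (fun n => lincomb x n (fun i => d i - d' i)) @ \oo --> (0 : X).
  under eq_fun do rewrite -lincombB.
  by rewrite -(subrr v); apply: cvgB; rewrite -series_lincomb.
have e1 : 0 < c * `|d k - d' k| / B by rewrite divr_gt0 ?mulr_gt0.
have [n0 hn0] := (cvg_seqP _ _).1 d0 _ e1.
have := hn0 (maxn n0 k.+1) (leq_maxl _ _).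
rewrite subr0 ltr_pdivlMr // mulrC.
have := @sign_coef k (maxn n0 k.+1) (fun i => d i - d' i) (leq_maxr _ _).
lra.
Qed.
End SignInequality.

(** * The summing functional *)

Lemma label_exists (b : nat -> nat) : strictly_increasing b -> b 0%N = 0%N ->
  exists kap : nat -> nat, forall i, (b (kap i) <= i < b (kap i).+1)%N.
Proof.
move=> b_inc b0.
suff /choice[kap h] i : exists k, (b k <= i < b k.+1)%N by exists kap.
elim: i => [|i [k /andP[h1 h2]]].
  by exists 0%N; rewrite b0 leqnn -b0 b_inc.
case: (ltnP i.+1 (b k.+1)) => h; first by exists k; rewrite h leqW.
by exists k.+1; rewrite h (leq_ltn_trans h2) // b_inc.
Qed.

Section Labels.
Context (b kap : nat -> nat).
Hypothesis b_inc : strictly_increasing b.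
Hypothesis kapP : forall i, (b (kap i) <= i < b (kap i).+1)%N.

Lemma label_uniq (i r : nat) : (b r <= i < b r.+1)%N -> kap i = r.
Proof.
move=> /andP[h1 h2]; have /andP[h3 h4] := kapP i.
case: (ltngtP (kap i) r) => // h.
  have := leq_strictly_increasing b_inc h; lia.
have := leq_strictly_increasing b_inc h; lia.
Qed.

Lemma label_mono : {homo kap : i j / (i <= j)%N}.
Proof.
move=> i j ij; rewrite leqNgt; apply/negP => h.
have /andP[h1 h2] := kapP i; have /andP[h3 h4] := kapP j.
have := leq_strictly_increasing b_inc h; lia.
Qed.

Hypothesis b0 : b 0%N = 0%N.

(** Turns combinations of blocks into plain combinations of the basis, whose coefficients depend on
    the label; the estimates for labelled classes then apply to them. *)
Lemma sum_label (V : nmodType) (F : nat -> nat -> V) (n : nat) :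
  \sum_(i < b n) F (kap i) i = \sum_(r < n) \sum_(b r <= i < b r.+1) F r i.
Proof.
elim: n => [|n ih]; first by rewrite b0 !big_ord0.
rewrite big_ord_recr /= -ih -!(big_mkord xpredT (fun i => F (kap i) i)).
have le_b : (b n <= b n.+1)%N by rewrite ltnW ?b_inc.
rewrite (big_cat_nat (leq0n _) le_b) /=; congr (_ + _).
by apply: eq_big_nat => i /label_uniq ->.
Qed.

Lemma sum_label_class (V : nmodType) (F : nat -> V) (n k : nat) :
  \sum_(i < b n | kap i == k) F i
    = if (k < n)%N then \sum_(b k <= i < b k.+1) F i else 0.
Proof.
rewrite big_mkcond (sum_label (fun r i => if r == k then F i else 0)) /=.
case: ltnP => kn.
  rewrite (bigD1 (Ordinal kn)) //= eqxx [X in _ + X]big1 ?addr0 // => r.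
  by rewrite -val_eqE /= => /negbTE ->; rewrite big1_eq.
apply: big1 => r _; rewrite ltn_eqF ?big1_eq //.
exact: leq_trans (ltn_ord r) kn.
Qed.

End Labels.

Lemma sum_translate (V : nmodType) (F : nat -> V) (m L : nat) :
  \sum_(m <= i < m + L) F i = \sum_(t < L) F (m + t)%N.
Proof.
rewrite -{1}[m]add0n big_addn addKn big_mkord.
by apply: eq_bigr => i _; rewrite addnC.
Qed.

Lemma sign_mul_norm (R : realType) (b : bool) (x : R) :
  `|(-1) ^+ b * x| = `|x|.
Proof. by rewrite normrM normrX normrN1 expr1n mul1r. Qed.

Section Conditional.
Context (R : realType) (X : completeNormedModType R) (N : X -> R).
Hypothesis N_equiv : equivalent_norm N.

Let N_add : forall u v : X, N (u + v) <= N u + N v. Proof. by case: N_equiv. Qed.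
Let N_scale : forall (a : R) (v : X), N (a *: v) = `|a| * N v.
Proof. by case: N_equiv. Qed.

Lemma equivalent_norm_unconditional (x : nat -> X) (c C : R) : 0 < c ->
  (forall k, c <= N (x k)) ->
  (forall n (a : nat -> R) (s : nat -> bool),
    N (lincomb x n (fun i => (-1) ^+ s i * a i)) <= C * N (lincomb x n a)) ->
  unconditional x.
Proof.
move=> c0 x_ge x_sign; have [_ _ [c1 [C1 [c1_gt0 C1_gt0 hN]]]] := N_equiv.
apply: (@sign_unconditional _ _ _ (c / C1) (`|C| * C1 / c1)) => [|k|n a s].
- by rewrite divr_gt0.
- rewrite ler_pdivrMr // mulrC; apply: le_trans (x_ge k) _.
  by have /andP[] := hN (x k).
- rewrite -(ler_pM2l c1_gt0).
  set u := lincomb x n _; set v := lincomb x n a.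
  have -> : c1 * (`|C| * C1 / c1 * `|v|) = `|C| * (C1 * `|v|).
    by field; rewrite gt_eqF.
  have /andP[h1 _] := hN u; have /andP[_ h2] := hN v.
  apply: le_trans h1 _; apply: le_trans (x_sign n a s) _.
  apply: (@le_trans _ _ (`|C| * N v)); last by rewrite ler_wpM2l.
  by rewrite ler_wpM2r ?ler_norm // seminorm_ge0.
Qed.

Context (e : nat -> X).
Hypothesis e_spreading : one_spreading N e.
Hypothesis e_schauder : schauder_basis e.
Hypothesis e_conditional : ~ unconditional e.

(** If [e 0] were 0, the zero vector would have two expansions. *)
Lemma basis_norm_gt0 : 0 < N (e 0%N).
Proof.
have [_ _ [c1 [C1 [c1_gt0 C1_gt0 hN]]]] := N_equiv.
have /andP[h _] := hN (e 0%N); apply: lt_le_trans h.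
rewrite mulr_gt0 // normr_gt0; apply/eqP => e0.
have [d [d0 d_uniq]] := e_schauder 0.
have h0 : expands e 0 (fun=> 0).
  rewrite /expands series_lincomb; apply: cvg_near_cst; near=> n.
  by apply: big1 => i _; rewrite scale0r.
have h1 : expands e 0 (fun i => (i == 0%N)%:R).
  rewrite /expands series_lincomb; apply: cvg_near_cst; near=> n.
  by apply: big1 => -[[|i] hi] _ /=; rewrite ?e0 ?scaler0 ?scale0r.
have := etrans (esym (d_uniq _ h0)) (d_uniq _ h1).
by move=> /(congr1 (@^~ 0%N)) /eqP; rewrite eq_sym oner_eq0.
Unshelve. all: by end_near.
Qed.

Lemma basis_sign_fails (C : R) :
  ~ (forall n (a : nat -> R) (s : nat -> bool),
    N (lincomb e n (fun i => (-1) ^+ s i * a i)) <= C * N (lincomb e n a)).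
Proof.
move=> h; apply: e_conditional.
apply: (equivalent_norm_unconditional basis_norm_gt0 _ h) => k.
by rewrite (spreading_norm e_spreading).
Qed.

(* Subtracting from e_i a copy of a small vector of sum 1 placed next to it gives
   zero-sum blocks, whose signs can be changed. *)
Lemma zero_sum_copies (L : nat) (c : nat -> R) (eps : R) (n : nat)
    (a : nat -> R) (s : nat -> bool) :
  \sum_(t < L) c t = 1 -> N (lincomb e L c) <= eps ->
  N (lincomb e n (fun i => (-1) ^+ s i * a i)) <=
    2 * N (lincomb e n a) + 3 * ((\sum_(i < n) `|a i|) * eps).
Proof.
(* Each block has one place for the basis vector and [L] places for the copy of [c] that is
   subtracted from it. *)
move=> c1 hc; pose b r := (r * L.+1)%N.
have b_inc : strictly_increasing b by move=> i j ij; rewrite /b ltn_pmul2r.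
have [kap kapP] := label_exists b_inc (mul0n _).
have b0 : b 0%N = 0%N by [].
pose g i : R := if i is t.+1 then - c t else 1.
pose V a' := lincomb e (b n) (fun j => a' (kap j) * g (j - b (kap j))%N).
have bS r : b r.+1 = (b r + L.+1)%N by rewrite /b mulSn addnC.
have VE (a' : nat -> R) : V a' = \sum_(r < n) a' r *: e (b r)
    - \sum_(r < n) a' r *: \sum_(t < L) c t *: e (b r + t.+1)%N.
  rewrite /V /lincomb (sum_label b_inc kapP b0
    (fun r j => (a' r * g (j - b r)%N) *: e j)) -sumrB.
  apply: eq_bigr => r _; rewrite bS sum_translate big_ord_recl /= addn0 subnn /=.
  rewrite mulr1 scaler_sumr -sumrN; congr (_ + _).
  apply: eq_bigr => t _; rewrite /bump /= add1n addKn /=.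
  by rewrite mulrN scaleNr scalerA.
have dV (a' : nat -> R) : N (\sum_(r < n) a' r *: \sum_(t < L) c t *: e (b r + t.+1)%N)
    <= (\sum_(i < n) `|a' i|) * eps.
  apply: le_trans (seminorm_sum N_add N_scale _ _ _) _; rewrite mulr_suml.
  apply: ler_sum => r _; rewrite N_scale ler_wpM2l //.
  rewrite (@spread_below _ _ _ _ e_spreading L (fun t => b r + t.+1)%N) //.
  by move=> i j ij _; rewrite ltn_add2l.
have bE (a' : nat -> R) : N (\sum_(r < n) a' r *: e (b r)) = N (lincomb e n a').
  by rewrite (@spread_below _ _ _ _ e_spreading n b) //; apply: strictly_increasing_below.
have hV : N (V (fun i => (-1) ^+ s i * a i)) <= 2 * N (V a).
  have -> : V (fun i => (-1) ^+ s i * a i) = lincomb e (b n)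
      (fun j => (-1) ^+ s (kap j) * (a (kap j) * g (j - b (kap j))%N)).
    by apply: eq_bigr => i _; rewrite mulrA.
  apply: (@sign_blocks _ _ _ N_add N_scale _ e_spreading kap (b n)
    (fun j => a (kap j) * g (j - b (kap j))%N) s (label_mono b_inc kapP)) => k.
  rewrite (sum_label_class b_inc kapP b0
    (fun j => a (kap j) * g (j - b (kap j))%N)); case: ifP => // _.
  rewrite (eq_big_nat _ _ (F2 := fun j => a k * g (j - b k)%N)).
    rewrite bS sum_translate -mulr_sumr big_ord_recl /= addn0 subnn /=.
    under eq_bigr do rewrite /bump /= add1n addKn /=.
    by rewrite sumrN c1 subrr mulr0.
  by move=> i /(label_uniq b_inc kapP) ->.
have := hV; rewrite !VE -(bE a) -(bE (fun i => (-1) ^+ s i * a i)).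
set A1 := \sum_(r < n) _; set A2 := \sum_(r < n) _.
set B1 := \sum_(r < n) _; set B2 := \sum_(r < n) _ => h1.
have h2 : N A2 <= (\sum_(i < n) `|a i|) * eps.
  apply: le_trans (dV (fun i => (-1) ^+ s i * a i)) _.
  by under eq_bigr do rewrite sign_mul_norm.
have h3 : N B2 <= (\sum_(i < n) `|a i|) * eps := dV a.
have := seminormB N_add N_scale B1 B2.
have := N_add (A1 - A2) A2; rewrite subrK.
lra.
Qed.

(** Otherwise there are vectors of coefficient sum 1 and arbitrarily small norm. The error term of
    [zero_sum_copies] then disappears, and the basis satisfies a sign inequality with constant 2. *)
Lemma summing_bounded : exists C : R, 0 < C /\
  forall n (a : nat -> R), `|\sum_(i < n) a i| <= C * N (lincomb e n a).
Proof.
apply: contrapT => hno; apply: (@basis_sign_fails 2) => n a s.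
apply/ler_addgt0Pr => eps e0.
(* Chosen so that a copy of norm at most [eps / S] costs at most [eps]; the summand 1 keeps [S]
   positive. *)
pose S := 3 * \sum_(i < n) `|a i| + 1.
have S0 : 0 < S by rewrite ltr_wpDl // mulr_ge0 // sumr_ge0.
have [L [c [c1 hc]]] : exists L (c : nat -> R),
    \sum_(t < L) c t = 1 /\ N (lincomb e L c) <= eps / S.
  apply: contrapT => hno2; apply: hno; exists (S / eps); split.
    by rewrite divr_gt0.
  move=> L c; rewrite leNgt; apply/negP => h; apply: hno2.
  have c0 : 0 < `|\sum_(i < L) c i|.
    apply: le_lt_trans h; apply: mulr_ge0 (seminorm_ge0 N_add N_scale _).
    by rewrite divr_ge0 // ltW.
  exists L, (fun i => (\sum_(i < L) c i)^-1 * c i); split.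
    by rewrite -mulr_sumr mulVf // -normr_gt0.
  have -> : lincomb e L (fun i => (\sum_(i < L) c i)^-1 * c i)
      = (\sum_(i < L) c i)^-1 *: lincomb e L c.
    by rewrite /lincomb scaler_sumr; apply: eq_bigr => i _; rewrite scalerA.
  rewrite N_scale normfV ler_pdivrMl //.
  have -> : N (lincomb e L c) = (S / eps * N (lincomb e L c)) * (eps / S).
    by field; rewrite !gt_eqF.
  by rewrite ler_wpM2r ?divr_ge0 ?ltW.
apply: le_trans (zero_sum_copies n a s c1 hc) _.
rewrite lerD2l [_ * (eps / S)]mulrA -/S mulrA ler_pdivrMr //.
rewrite /S; nra.
Qed.

End Conditional.

(** * Boundedness of the partial sums of the coefficients *)

Section PartialSums.
Context (R : realType) (X : completeNormedModType R) (N : X -> R).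
Hypothesis N_equiv : equivalent_norm N.

Let N_add : forall u v : X, N (u + v) <= N u + N v. Proof. by case: N_equiv. Qed.
Let N_scale : forall (a : R) (v : X), N (a *: v) = `|a| * N v.
Proof. by case: N_equiv. Qed.
Let N_ge0 (v : X) : 0 <= N v. Proof. exact: seminorm_ge0. Qed.

Context (e : nat -> X).
Hypothesis e_spreading : one_spreading N e.

Definition initial_average (P : nat) : X := P%:R^-1 *: \sum_(t < P) e t.

Lemma average_norm (m P : nat) :
  N (P%:R^-1 *: \sum_(t < P) e (m + t)%N) <= N (e 0%N).
Proof.
rewrite N_scale ger0_norm ?invr_ge0 //.
have [->|P0] := posnP P; first by rewrite invr0 mul0r.
rewrite ler_pdivrMl ?ltr0n //; apply: le_trans (seminorm_sum N_add N_scale _ _ _) _.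
under eq_bigr do rewrite (spreading_norm e_spreading).
by rewrite sumr_const card_ord mulr_natl.
Qed.

(** Split [c] at [m] into a left part of sum 1 and a right part whose sum is nearly -1, since the
    total is at most [C * eps]. Averaging over translates of both parts replaces them by a multiple
    of an initial average and a multiple of a distant one, which are therefore close. *)
Lemma average_dist (C eps : R) (n m : nat) (c : nat -> R) :
  (forall n (a : nat -> R), `|\sum_(i < n) a i| <= C * N (lincomb e n a)) ->
  0 <= C ->
  (m <= n)%N -> \sum_(i < m) c i = 1 -> N (lincomb e n c) <= eps ->
  exists K : R, forall P P' Q : nat, (0 < P)%N -> (P <= P')%N -> (0 < Q)%N ->
    N (initial_average P - Q%:R^-1 *: \sum_(t < Q) e (P' + t)%N)
      <= (1 + C * N (e 0%N)) * eps + K / P%:R + K / Q%:R.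
Proof.
move=> hC C0 mn c1 hc.
exists (\sum_(i < n) `|c i| * (i%:R * (2 * N (e 0%N)))) => P P' Q P0 PP' Q0.
pose l i := if (i < m)%N then c i else 0.
pose r i := if (i < m)%N then 0 else c i.
set K := \sum_(i < n) _.
have lK : \sum_(i < n) `|l i| * (i%:R * (2 * N (e 0%N))) <= K.
  apply: ler_sum => i _; rewrite ler_wpM2r ?mulr_ge0 //.
  by rewrite /l; case: ifP => //; rewrite normr0.
have rK : \sum_(i < n) `|r i| * (i%:R * (2 * N (e 0%N))) <= K.
  apply: ler_sum => i _; rewrite ler_wpM2r ?mulr_ge0 //.
  by rewrite /r; case: ifP => //; rewrite normr0.
have l1 : \sum_(i < n) l i = 1.
  rewrite -c1 (big_ord_widen _ c mn) [RHS]big_mkcond.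
  by apply: eq_bigr => i _; rewrite /l.
have rs : \sum_(i < n) r i = \sum_(i < n) c i - 1.
  rewrite -l1 -sumrB; apply: eq_bigr => i _; rewrite /l /r.
  by case: ifP; rewrite ?subrr ?subr0.
(* The left part stays before [m + P] and the right part starts at [m + P'] or later, so [P <= P']
   keeps the order of the indices. *)
have both t t' : (t < P)%N ->
    N (\sum_(i < n) r i *: e (P' + (i + t'))%N + \sum_(i < n) l i *: e (i + t)%N)
    <= eps.
  move=> tP; pose phi i := if (i < m)%N then (i + t)%N else (P' + (i + t'))%N.
  have phi_inc : increasing_below n phi.
    move=> i j ij jn; rewrite /phi.
    by case: (ltnP i m) => ?; case: (ltnP j m) => ?; lia.
  apply: le_trans hc; rewrite -(spread_below e_spreading c phi_inc).
  rewrite le_eqVlt; apply/orP; left; apply/eqP; congr N.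
  rewrite -big_split; apply: eq_bigr => i _; rewrite /phi /l /r /=.
  by case: ifP; rewrite scale0r ?add0r ?addr0.
have step1 t' : N (1 *: initial_average P
    + \sum_(i < n) r i *: e (P' + (i + t'))%N) <= eps + K / P%:R.
  have hb j : N (e j) <= N (e 0%N) by rewrite (spreading_norm e_spreading).
  have := seminorm_translate_average N_add N_scale hb P0 (fun t => @both t t').
  rewrite l1 addrC => h; apply: le_trans h _.
  by rewrite lerD2l ler_wpM2r ?invr_ge0.
have step2 : N (1 *: initial_average P + (\sum_(i < n) r i) *:
    (Q%:R^-1 *: \sum_(t < Q) e (P' + t)%N)) <= eps + K / P%:R + K / Q%:R.
  have hb j : N (e (P' + j)%N) <= N (e 0%N) by rewrite (spreading_norm e_spreading).
  have h := seminorm_translate_average N_add N_scale hb Q0 (fun t _ => step1 t).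
  by apply: le_trans h _; rewrite lerD2l ler_wpM2r ?invr_ge0.
set B := Q%:R^-1 *: _; rewrite rs scale1r -/B in step2.
(* The right part contributes the total sum minus 1 times [B]; the multiple by the total sum is a
   small error. *)
have B_le : N B <= N (e 0%N) by apply: average_norm.
have s_le : `|\sum_(i < n) c i| <= C * eps.
  by apply: le_trans (hC n c) _; rewrite ler_wpM2l.
rewrite (_ : _ - B = (initial_average P + (\sum_(i < n) c i - 1) *: B)
  - (\sum_(i < n) c i) *: B); last first.
  by rewrite scalerBl scale1r -addrA; congr (_ + _); rewrite addrAC subrr sub0r.
apply: le_trans (seminormB N_add N_scale _ _) _.
rewrite N_scale; apply: le_trans (lerD step2 _) _.
  exact: ler_pM (normr_ge0 _) (N_ge0 B) s_le B_le.
rewrite le_eqVlt; apply/orP; left; apply/eqP; ring.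
Qed.

Hypothesis e_schauder : schauder_basis e.
Hypothesis e_conditional : ~ unconditional e.

(* The limit of the averages would be invariant under e_i -> e_{i+1}, so by
   uniqueness all its coordinates would be equal to 0. *)
Lemma averages_not_cvg (v : X) : ~ (initial_average @ \oo --> v).
Proof.
move=> avg_cvg.
have [_ _ [c1 [C1 [c1_gt0 C1_gt0 hN]]]] := N_equiv.
have avg_N eps : 0 < eps ->
    exists n0, forall n, (n0 <= n)%N -> N (initial_average n - v) < eps.
  move=> e0; have [n0 hn0] := (cvg_seqP _ _).1 avg_cvg _ (divr_gt0 e0 C1_gt0).
  exists n0 => n /hn0; rewrite ltr_pdivlMr // mulrC => h.
  by apply: le_lt_trans h; have /andP[] := hN (initial_average n - v).
have [d [d_exp d_uniq]] := e_schauder v.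
have d_N eps : 0 < eps ->
    exists n0, forall n, (n0 <= n)%N -> N (lincomb e n d - v) < eps.
  move=> e0; rewrite /expands series_lincomb in d_exp.
  have [n0 hn0] := (cvg_seqP _ _).1 d_exp _ (divr_gt0 e0 C1_gt0).
  exists n0 => n /hn0; rewrite ltr_pdivlMr // mulrC => h.
  by apply: le_lt_trans h; have /andP[] := hN (lincomb e n d - v).
(* The coefficients shifted by one place; they are shown to expand [v] too. *)
pose sd i := if i is j.+1 then d j else 0.
have sd_lincomb n : lincomb e n.+1 sd = \sum_(i < n) d i *: e i.+1.
  by rewrite /lincomb big_ord_recl scale0r add0r.
have sd_exp : expands e v sd.
  rewrite /expands series_lincomb; apply/cvg_seqP => eps e0.
  have e1 : 0 < c1 * eps / 5 by rewrite divr_gt0 ?mulr_gt0.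
  have [n1 hn1] := d_N _ e1; have [n2 hn2] := avg_N _ e1.
  have e2 : 0 < c1 * eps / 5 / (2 * N (e 0%N)).
    by rewrite divr_gt0 // mulr_gt0 // (basis_norm_gt0 N_equiv).
  have [n3 hn3] := inv_natS_lt e2.
  exists n1.+1 => -[//|n]; rewrite ltnS => /hn1 h1.
  pose M := (maxn n2 n3).+1.
  have h2 : N (initial_average M - v) < c1 * eps / 5.
    by apply: hn2; rewrite /M leqW // leq_maxl.
  have shift : N (M%:R^-1 *: (\sum_(t < M) e t.+1) - initial_average M)
      < c1 * eps / 5.
    rewrite -scalerBr N_scale ger0_norm ?invr_ge0 //.
    have hb j : N (e j) <= N (e 0%N) by rewrite (spreading_norm e_spreading).
    have h3 : N (\sum_(t < M) e t.+1 - \sum_(t < M) e t) <= 2 * N (e 0%N).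
      by have := seminorm_translate N_add N_scale M 1 hb; rewrite mul1r.
    have h4 := hn3 _ (leq_maxr n2 n3); rewrite -/M ltr_pdivlMr in h4; last first.
      by rewrite mulr_gt0 // (basis_norm_gt0 N_equiv).
    by apply: le_lt_trans h4; rewrite ler_wpM2l ?invr_ge0.
  (* Shifting the partial sum and the average together preserves their distance, while shifting the
     average alone hardly moves it. *)
  have close : N (\sum_(i < n) d i *: e i.+1 - M%:R^-1 *: (\sum_(t < M) e t.+1))
      = N (lincomb e n d - initial_average M).
    pose q := maxn n M.
    pose b i := (if (i < n)%N then d i else 0) - (if (i < M)%N then M%:R^-1 else 0).
    have h (phi : nat -> nat) : \sum_(i < q) b i *: e (phi i)
        = \sum_(i < n) d i *: e (phi i) - M%:R^-1 *: (\sum_(t < M) e (phi t)).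
      rewrite /b; under eq_bigr do rewrite scalerBl.
      rewrite sumrB; congr (_ - _).
        exact: (lincomb_pad (e \o phi) d (leq_maxl n M)).
      rewrite scaler_sumr.
      exact: (lincomb_pad (e \o phi) (fun=> M%:R^-1) (leq_maxr n M)).
    rewrite -(h S) -(h id).
    by apply: (@spread_below_eq _ _ _ _ e_spreading q S id b) => i j.
  have /andP[hv _] := hN (lincomb e n.+1 sd - v).
  rewrite -(ltr_pM2l c1_gt0); apply: le_lt_trans hv _; rewrite sd_lincomb.
  move: close h1 h2 shift; set A := \sum_(i < n) _; set B := M%:R^-1 *: _.
  set D := lincomb e n d; set I := initial_average M => close h1 h2 shift.
  have := N_add (A - B) (B - v); rewrite addrA subrK close.
  have := N_add (B - I) (I - v); rewrite addrA subrK.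
  have := N_add (D - v) (v - I); rewrite addrA subrK.
  rewrite (seminorm_distC N_scale v I); lra.
have d0 k : d k = 0.
  have dsd : d = sd by apply: d_uniq.
  by elim: k => [|k ih]; rewrite dsd //= ih.
(* Hence the averages tend to 0, although their coefficient sums are 1: this contradicts the
   boundedness of the summing functional. *)
have [C [C0 hC]] := summing_bounded N_equiv e_spreading e_schauder e_conditional.
have e1 : 0 < (2 * C)^-1 by rewrite invr_gt0 mulr_gt0.
have [n1 /(_ n1 (leqnn _)) h1] := d_N _ e1.
have [n2 /(_ n2.+1 (leqnSn _)) h2] := avg_N _ e1.
have Nv : N v < (2 * C)^-1.
  rewrite /lincomb big1 ?sub0r ?(seminormN N_scale) // in h1.
  by move=> i _; rewrite d0 scale0r.
have := hC n2.+1 (fun=> n2.+1%:R^-1).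
rewrite sumr_const card_ord -[_ *+ _]mulr_natl divff ?pnatr_eq0 // normr1.
have -> : lincomb e n2.+1 (fun=> n2.+1%:R^-1) = initial_average n2.+1.
  by rewrite /initial_average scaler_sumr.
have := N_add (initial_average n2.+1 - v) v; rewrite subrK => h3.
apply/negP; rewrite -ltNge.
have -> : 1 = C * ((2 * C)^-1 + (2 * C)^-1) by field; rewrite gt_eqF.
by rewrite ltr_pM2l //; apply: le_lt_trans h3 _; apply: ltrD.
Qed.

(** Otherwise there are vectors of small norm with a partial sum equal to 1, and by [average_dist]
    the initial averages form a Cauchy sequence, which [averages_not_cvg] excludes. *)
Lemma partial_sums_bounded : exists C : R, 0 < C /\
  forall n m (a : nat -> R), (m <= n)%N ->
    `|\sum_(i < m) a i| <= C * N (lincomb e n a).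
Proof.
have [C [C0 hC]] := summing_bounded N_equiv e_spreading e_schauder e_conditional.
apply: contrapT => hno.
have small eps : 0 < eps -> exists n m (c : nat -> R),
    [/\ (m <= n)%N, \sum_(i < m) c i = 1 & N (lincomb e n c) <= eps].
  move=> e0; apply: contrapT => hno2; apply: hno; exists eps^-1; split.
    by rewrite invr_gt0.
  move=> n m c mn; rewrite leNgt; apply/negP => h; apply: hno2.
  have c0 : 0 < `|\sum_(i < m) c i|.
    by apply: le_lt_trans h; rewrite mulr_ge0 // invr_ge0 ltW.
  exists n, m, (fun i => (\sum_(i < m) c i)^-1 * c i); split => //.
    by rewrite -mulr_sumr mulVf // -normr_gt0.
  have -> : lincomb e n (fun i => (\sum_(i < m) c i)^-1 * c i)
      = (\sum_(i < m) c i)^-1 *: lincomb e n c.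
    by rewrite /lincomb scaler_sumr; apply: eq_bigr => i _; rewrite scalerA.
  by rewrite N_scale normfV ler_pdivrMl // -ler_pdivrMr // mulrC ltW.
suff [v hv] : exists v : X, initial_average @ \oo --> v.
  exact: averages_not_cvg hv.
have [_ _ [c1 [C1 [c1_gt0 C1_gt0 hN]]]] := N_equiv.
apply: cauchy_seq_cvg => eps e0.
pose D := 1 + C * N (e 0%N).
have D0 : 0 < D by rewrite ltr_pwDl // mulr_ge0 // ltW.
have e1 : 0 < c1 * eps / 7 / D by rewrite !divr_gt0 ?mulr_gt0.
have [n [m [c [mn c_1 hc]]]] := small _ e1.
have [K hK] := average_dist hC (ltW C0) mn c_1 hc.
have e2 : 0 < c1 * eps / 7 / (1 + `|K|) by rewrite !divr_gt0 ?mulr_gt0 // ltr_pwDl.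
have [n0 hn0] := inv_natS_lt e2.
have Kn q : (n0 < q)%N -> K / q%:R < c1 * eps / 7.
  case: q => // q; rewrite ltnS => /hn0; rewrite ltr_pdivlMr ?ltr_pwDl // => h.
  apply: le_lt_trans h; rewrite mulrC ler_wpM2l ?invr_ge0 //.
  by rewrite (le_trans (ler_norm K)) // lerDr.
exists n0.+1 => p q n0p n0q.
have p0 : (0 < p)%N by apply: leq_ltn_trans n0p.
have q0 : (0 < q)%N by apply: leq_ltn_trans n0q.
(* Both initial averages are compared with the same average [J] of length [p], which starts beyond
   them. Each comparison has three error terms, so six terms are covered by sevenths of
   [c1 * eps]. *)
have := hK p (maxn p q) p p0 (leq_maxl _ _) p0.
have := hK q (maxn p q) p q0 (leq_maxr _ _) p0.
set J := p%:R^-1 *: _; rewrite -/D.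
have -> : D * (c1 * eps / 7 / D) = c1 * eps / 7 by field; rewrite gt_eqF.
move: (Kn p n0p) (Kn q n0q).
move: (initial_average p) (initial_average q) => A B h1 h2 h3 h4.
have h5 := N_add (A - J) (J - B); rewrite addrA subrK in h5.
rewrite (seminorm_distC N_scale J B) in h5.
have /andP[h6 _] := hN (A - B).
rewrite -(ltr_pM2l c1_gt0); apply: le_lt_trans h6 _.
have h7 : 0 < c1 * eps by apply: mulr_gt0.
move: (K / p%:R) (K / q%:R) h1 h2 h3 h4 => kp kq h1 h2 h3 h4; lra.
Qed.

End PartialSums.

(** * Combinations with small partial sums *)

Section Cumulative.
Context (R : realType) (mu : nat -> R) (delta : R).
Hypothesis mu_ge0 : forall i, 0 <= mu i.

Definition cumul (n : nat) : R := \sum_(i < n) mu i.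

Lemma cumulS (n : nat) : cumul n.+1 = cumul n + mu n.
Proof. by rewrite /cumul big_ord_recr. Qed.

Lemma cumul_mono (m n : nat) : (m <= n)%N -> cumul m <= cumul n.
Proof.
move=> /subnK <-; elim: (n - m)%N => [//|k ih].
by rewrite addSn cumulS ler_wpDr.
Qed.

(** [cumul] is monotone, so the condition cuts out an initial segment. A sum over one level is thus
    a difference of two partial sums. *)
Lemma below_level (n : nat) (x : R) : exists m, (m <= n)%N /\
  forall (V : nmodType) (F : nat -> V),
    \sum_(i < n | cumul i < x) F i = \sum_(i < m) F i.
Proof.
elim: n => [|n [m [mn hm]]].
  by exists 0%N; split => // V F; rewrite !big_ord0.
case: (ltP (cumul n) x) => h.
  exists n.+1; split => // V F; apply: eq_bigl => i.
  by apply: le_lt_trans h; rewrite cumul_mono // -ltnS.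
exists m; split=> [|V F]; first exact: leqW.
by rewrite big_mkcond big_ord_recr /= ltNge h addr0 -big_mkcond hm.
Qed.

Lemma level_mass_ge (n : nat) (x y : R) : y <= x -> y <= cumul n ->
  y <= \sum_(i < n | cumul i < x) mu i.
Proof.
elim: n => [|n ih] yx yn.
  by rewrite big_ord0; rewrite /cumul big_ord0 in yn.
rewrite big_mkcond big_ord_recr /= -big_mkcond.
case: ltP => h.
  rewrite (eq_bigl xpredT) => [|i]; first by rewrite -cumulS.
  by apply: le_lt_trans h; rewrite cumul_mono // ltnW.
by rewrite addr0; apply: ih => //; apply: le_trans h.
Qed.

Lemma level_mass_le_total (n : nat) (x : R) :
  \sum_(i < n | cumul i < x) mu i <= cumul n.
Proof.
rewrite big_mkcond; apply: ler_sum => i _.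
by case: ifP => // _; rewrite mu_ge0.
Qed.

Hypothesis mu_le : forall i, mu i <= delta.

(** Only the last index below the level can overshoot it, by one weight. *)
Lemma level_mass_le (n : nat) (x : R) : 0 <= x ->
  \sum_(i < n | cumul i < x) mu i <= x + delta.
Proof.
move=> x0; have d0 : 0 <= delta by apply: le_trans (mu_ge0 0%N) (mu_le 0%N).
elim: n => [|n ih]; first by rewrite big_ord0 addr_ge0.
rewrite big_mkcond big_ord_recr /= -big_mkcond.
case: ltP => h; last by rewrite addr0.
apply: lerD (mu_le n); apply: le_trans (level_mass_le_total _ _) _.
exact: ltW.
Qed.

Context (K : nat).
Hypothesis K_gt0 : (0 < K)%N.

Let K0 : 0 < K%:R :> R. Proof. by rewrite ltr0n. Qed.

(* The index of the slice of length 1/K that contains the mass preceding i. *)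
Definition level (i : nat) : nat := Num.truncn (K%:R * cumul i).

Lemma cumul_ge0 (i : nat) : 0 <= cumul i.
Proof. exact: sumr_ge0. Qed.

Lemma level_mono : {homo level : i j / (i <= j)%N}.
Proof.
move=> i j ij; apply: le_truncn; rewrite ler_wpM2l ?cumul_mono //.
Qed.

Lemma level_lt (i k : nat) : (level i < k)%N = (cumul i < k%:R / K%:R).
Proof.
rewrite /level truncn_lt_nat ?mulr_ge0 ?cumul_ge0 //.
by rewrite ltr_pdivlMr // mulrC.
Qed.

Lemma level_sum (V : zmodType) (n k : nat) (F : nat -> V) :
  \sum_(i < n | level i == k) F i = \sum_(i < n | cumul i < k.+1%:R / K%:R) F i
    - \sum_(i < n | cumul i < k%:R / K%:R) F i.
Proof.
rewrite [X in X - _]big_mkcond [X in _ - X]big_mkcond [LHS]big_mkcond -sumrB.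
apply: eq_bigr => i _; rewrite -!level_lt ltnS.
by case: (ltngtP (level i) k) => h; rewrite ?subrr ?subr0.
Qed.

Lemma level_mass_ub (n k : nat) :
  \sum_(i < n | level i == k) mu i <= K%:R^-1 + delta.
Proof.
have d0 : 0 <= delta by apply: le_trans (mu_ge0 0%N) (mu_le 0%N).
rewrite level_sum; case: (leP (k%:R / K%:R) (cumul n)) => h.
  have h1 := level_mass_ge (lexx _) h.
  have := @level_mass_le n (k.+1%:R / K%:R) (divr_ge0 (ler0n _ _) (ltW K0)).
  rewrite -natr1 mulrDl mul1r; move: (K%:R^-1) h1 => ?; lra.
have := @level_mass_ge n _ _ (ltW h) (lexx _).
have := level_mass_le_total n (k.+1%:R / K%:R).
have : 0 <= K%:R^-1 :> R by rewrite invr_ge0.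
move: (K%:R^-1) => ?; lra.
Qed.

Lemma level_mass_lb (n k : nat) : k.+1%:R / K%:R <= cumul n ->
  K%:R^-1 - delta <= \sum_(i < n | level i == k) mu i.
Proof.
move=> h; rewrite level_sum.
have := level_mass_ge (lexx _) h.
have := @level_mass_le n (k%:R / K%:R) (divr_ge0 (ler0n _ _) (ltW K0)).
rewrite -natr1 mulrDl mul1r; move: (K%:R^-1) => ?; lra.
Qed.

(** The whole mass 1 is already used up before [i]. *)
Lemma level_ge_null (n i : nat) : cumul n = 1 -> (i < n)%N ->
  (K <= level i)%N -> mu i = 0.
Proof.
move=> n1 i_n; rewrite leqNgt level_lt -leNgt divff ?gt_eqF // => h.
have := cumul_mono i_n; rewrite cumulS n1.
have := mu_ge0 i; lra.
Qed.

End Cumulative.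

Lemma sum_double (V : nmodType) (F : nat -> V) (n : nat) :
  \sum_(j < n.*2) F j = \sum_(k < n) (F k.*2 + F k.*2.+1).
Proof.
elim: n => [|n ih]; first by rewrite !big_ord0.
by rewrite doubleS !big_ord_recr /= ih addrA.
Qed.

(** * Convexity and sums of successive differences *)

Section Convexity.
Context (R : realType) (X : normedModType R) (N : X -> R).
Hypothesis N_add : forall u v : X, N (u + v) <= N u + N v.
Hypothesis N_scale : forall (a : R) (v : X), N (a *: v) = `|a| * N v.

(** The l1-ball of radius [beta] is the convex hull of the vectors with one coordinate equal to
    [beta] or [- beta], and a seminorm is convex. The mass that [a] does not use is put on [u],
    which is a midpoint of two such vectors. *)
Lemma seminorm_convex (n : nat) (u : X) (f : nat -> X) (a : nat -> R) (beta M : R) :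
  0 < beta ->
  (forall i (s : bool), N (u + ((-1) ^+ s * beta) *: f i) <= M) ->
  \sum_(i < n) `|a i| <= beta -> N (u + \sum_(i < n) a i *: f i) <= M.
Proof.
move=> beta0 h ha.
have hu : N u <= M.
  have := h 0%N true; have := h 0%N false; rewrite expr1 expr0 mul1r mulN1r scaleNr.
  set v := beta *: _ => h1 h2; have := N_add (u + v) (u - v).
  have -> : u + v + (u - v) = 2 *: u by rewrite addrACA subrr addr0 scaler_nat mulr2n.
  rewrite N_scale ger0_norm //; lra.
rewrite -(ler_pM2l beta0) -{1}(gtr0_norm beta0) -N_scale.
have -> : beta *: (u + \sum_(i < n) a i *: f i)
    = (beta - \sum_(i < n) `|a i|) *: u
      + \sum_(i < n) `|a i| *: (u + ((-1) ^+ (a i < 0)%R * beta) *: f i).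
  under [X in _ = _ + X]eq_bigr do rewrite scalerDr scalerA.
  rewrite big_split /= -scaler_suml addrA -scalerDl subrK scalerDr scaler_sumr.
  congr (_ + _); apply: eq_bigr => i _; rewrite scalerA; congr (_ *: _).
  by rewrite -[in LHS](mulr_sign_norm (a i)); ring.
apply: le_trans (N_add _ _) _; rewrite N_scale ger0_norm ?subr_ge0 //.
have hs : N (\sum_(i < n) `|a i| *: (u + ((-1) ^+ (a i < 0)%R * beta) *: f i))
    <= (\sum_(i < n) `|a i|) * M.
  apply: le_trans (seminorm_sum N_add N_scale _ _ _) _; rewrite mulr_suml.
  by apply: ler_sum => i _; rewrite N_scale normr_id ler_wpM2l.
have := ler_wpM2l (_ : 0 <= beta - \sum_(i < n) `|a i|) hu.
rewrite subr_ge0 => /(_ ha); lra.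
Qed.

Lemma seminorm_convex_choice (n : nat) (f : nat -> nat -> X)
    (a : nat -> nat -> R) (beta M : R) (K : nat) (u : X) : 0 < beta ->
  (forall (c : nat -> nat) (s : nat -> bool),
    N (u + \sum_(k < K) ((-1) ^+ s k * beta) *: f k (c k)) <= M) ->
  (forall k, (k < K)%N -> \sum_(i < n) `|a k i| <= beta) ->
  N (u + \sum_(k < K) \sum_(i < n) a k i *: f k i) <= M.
Proof.
move=> beta0; elim: K u => [|K ih] u h ha.
  by have := h id xpredT; rewrite !big_ord0.
rewrite big_ord_recr /= addrA; apply: seminorm_convex (ha K (ltnSn K)) => // i s.
rewrite addrAC; apply: ih => [c s'|k kK]; last by apply: ha; apply: ltnW.
(* The extreme point of the last class is frozen at [i] and [s] while the induction treats the other
   classes. *)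
have := h (fun k => if (k < K)%N then c k else i)
  (fun k => if (k < K)%N then s' k else s).
rewrite big_ord_recr /= ltnn addrA addrAC.
by under eq_bigr do rewrite ltn_ord.
Qed.

Context (e : nat -> X).
Hypothesis e_spreading : one_spreading N e.

Definition difference_norm (K : nat) : R :=
  N (\sum_(k < K) (e k.*2 - e k.*2.+1)).

Lemma pair_sum (p q : nat -> nat) (b : nat -> R) (n : nat) :
  \sum_(k < n) b k *: (e (p k) - e (q k))
  = \sum_(j < n.*2) ((-1) ^+ odd j * b j./2) *: e ((if odd j then q else p) j./2).
Proof.
rewrite (sum_double (fun j =>
  ((-1) ^+ odd j * b j./2) *: e ((if odd j then q else p) j./2))).
apply: eq_bigr => k _ /=.
rewrite odd_double doubleK uphalf_double /= expr0 expr1 mul1r mulN1r.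
by rewrite scalerBr scaleNr.
Qed.

Lemma pair_spread (p q : nat -> nat) (b : nat -> R) (n : nat) :
  (forall k, (p k < q k)%N) -> (forall k, (q k < p k.+1)%N) ->
  N (\sum_(k < n) b k *: (e (p k) - e (q k)))
    = N (\sum_(k < n) b k *: (e k.*2 - e k.*2.+1)).
Proof.
move=> pq qp; rewrite pair_sum (pair_sum double (fun k => k.*2.+1)).
have p_mono k l : (k < l)%N -> (q k < p l)%N.
  elim: l => [//|l ih]; rewrite ltnS leq_eqVlt => /orP[/eqP->//|/ih h].
  by apply: ltn_trans h _; apply: ltn_trans (pq l) (qp l).
have inc p' q' : (forall k, (p' k < q' k)%N) ->
    (forall k l, (k < l)%N -> (q' k < p' l)%N) ->
    increasing_below n.*2 (fun j => (if odd j then q' else p') j./2).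
  move=> h1 h2 i j ij _; have h3 := h1 i./2; have h4 := h1 j./2.
  have [h|h] := ltnP i./2 j./2.
    by have := h2 _ _ h; case: (odd i); case: (odd j); lia.
  have i2 : i./2 = j./2 by lia.
  have [-> ->] : odd i = false /\ odd j = true by lia.
  by rewrite i2.
apply: (@spread_below_eq _ _ _ _ e_spreading n.*2
  (fun j => (if odd j then q else p) j./2)
  (fun j => (if odd j then fun k => k.*2.+1 else double) j./2)
  (fun j => (-1) ^+ odd j * b j./2)).
  exact: inc.
by apply: (inc double (fun k => k.*2.+1)) => // k l kl; lia.
Qed.

(** The pairs are successive zero-sum blocks, labelled by [half]. *)
Lemma pair_sign (b : nat -> R) (s : nat -> bool) (n : nat) :
  N (\sum_(k < n) ((-1) ^+ s k * b k) *: (e k.*2 - e k.*2.+1))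
    <= 2 * N (\sum_(k < n) b k *: (e k.*2 - e k.*2.+1)).
Proof.
have sumE (b' : nat -> R) : \sum_(k < n) b' k *: (e k.*2 - e k.*2.+1)
    = lincomb e n.*2 (fun j => (-1) ^+ odd j * b' j./2).
  rewrite (pair_sum double (fun k => k.*2.+1)); apply: eq_bigr => j _.
  by congr (_ *: e _); rewrite -[RHS]odd_double_half; case: (odd j).
rewrite (sumE (fun k => (-1) ^+ s k * b k)) (sumE b).
have -> : lincomb e n.*2 (fun j => (-1) ^+ odd j * ((-1) ^+ s j./2 * b j./2))
    = lincomb e n.*2 (fun j => (-1) ^+ s j./2 * ((-1) ^+ odd j * b j./2)).
  by apply: eq_bigr => j _; rewrite mulrCA.
apply: (@sign_blocks _ _ _ N_add N_scale _ e_spreading half n.*2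
  (fun j => (-1) ^+ odd j * b j./2) s half_leq) => k.
rewrite big_mkcond (sum_double (fun j =>
  if j./2 == k then (-1) ^+ odd j * b j./2 else 0)) big1 // => i _ /=.
rewrite odd_double doubleK uphalf_double /= expr0 expr1 mul1r mulN1r.
by case: eqP => _; rewrite ?subrr ?addr0.
Qed.

(* Each class kap = k is compared, up to its sum, with the reference index
   B * (Q + k); by convexity only the vectors +- beta (e_i - e_{B (Q + k)})
   matter, one for each class, and these are spread successive pairs. *)
Lemma core_estimate (Q B K n : nat) (T : pred nat) (kap pos : nat -> nat)
    (a : nat -> R) (beta sigma : R) :
  0 < beta -> (1 < B)%N ->
  (forall i, (i < n)%N -> T i ->
    (kap i < K)%N && (B * (Q + kap i) < pos i < B * (Q + kap i).+1)%N) ->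
  (forall k, (k < K)%N ->
    \sum_(i < n | T i && (kap i == k)) `|a i| <= beta) ->
  (forall k, (k < K)%N ->
    `|\sum_(i < n | T i && (kap i == k)) a i| <= sigma) ->
  N (\sum_(i < n | T i) a i *: e (pos i))
    <= 2 * beta * difference_norm K + K%:R * sigma * N (e 0%N).
Proof.
move=> beta0 B1 hpos hmass hsum.
pose q k := (B * (Q + k))%N.
(* The default keeps [g k i] strictly between [q k] and [q k.+1] for all [i], because [1 < B]; any
   choice of one index per class then gives spread pairs. *)
pose g k i := if [&& (i < n)%N, T i & kap i == k] then pos i else (q k).+1.
pose A k i := if T i && (kap i == k) then a i else 0.
have qg k i : (q k < g k i)%N.
  rewrite /g; case: and3P => // -[i_n Ti /eqP <-].
  by have /and3P[] := hpos i i_n Ti.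
have gq k i : (g k i < q k.+1)%N.
  rewrite /g; case: and3P => [[i_n Ti /eqP <-]|_].
    by have /and3P[_ _] := hpos i i_n Ti; rewrite /q addnS.
  by rewrite /q; nia.
have -> : \sum_(i < n | T i) a i *: e (pos i)
    = (0 + \sum_(k < K) \sum_(i < n) A k i *: (e (g k i) - e (q k)))
      + \sum_(k < K) (\sum_(i < n) A k i) *: e (q k).
  rewrite add0r -big_split /=.
  under [RHS]eq_bigr => k _.
    under eq_bigr do rewrite scalerBr.
    rewrite sumrB scaler_suml subrK; over.
  rewrite exchange_big big_mkcond; apply: eq_bigr => i _.
  case Ti : (T i); last by rewrite big1 // => k _; rewrite /A Ti scale0r.
  have /and3P[iK _ _] := hpos i (ltn_ord i) Ti.
  rewrite (bigD1 (Ordinal iK)) //= big1 => [|k].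
    by rewrite addr0 /A /g Ti eqxx ltn_ord.
  rewrite -val_eqE /= eq_sym => h.
  by rewrite /A Ti (negbTE h) scale0r.
apply: le_trans (N_add _ _) (lerD _ _).
- apply: (@seminorm_convex_choice n (fun k i => e (g k i) - e (q k)) A beta)
    => // [c s|k kK].
  + rewrite add0r.
    rewrite (_ : \sum_(k < K) _ = - \sum_(k < K) ((-1) ^+ s k * beta) *:
        (e (q k) - e (g k (c k)))); last first.
      by rewrite -sumrN; apply: eq_bigr => k _; rewrite -scalerN opprB.
    rewrite (seminormN N_scale) (@pair_spread q (fun k => g k (c k))
      (fun k => (-1) ^+ s k * beta)) //.
    apply: le_trans (pair_sign (fun=> beta) s K) _.
    by rewrite -scaler_sumr N_scale gtr0_norm // mulrA.
  + apply: le_trans (hmass k kK); rewrite [leRHS]big_mkcond.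
    by apply: ler_sum => i _; rewrite /A; case: ifP; rewrite ?normr0.
- apply: le_trans (lincomb_le_mass N_add N_scale e_spreading K q
    (fun k => \sum_(i < n) A k i)) _.
  rewrite ler_wpM2r ?(seminorm_ge0 N_add N_scale) //.
  rewrite mulr_natl -[K in leRHS]card_ord -sumr_const; apply: ler_sum => k _.
  by apply: le_trans (hsum k (ltn_ord k)); rewrite [in leRHS]big_mkcond.
Qed.

End Convexity.

Section SmallSums.
Context (R : realType) (X : completeNormedModType R) (N : X -> R).
Hypothesis N_equiv : equivalent_norm N.

Let N_add : forall u v : X, N (u + v) <= N u + N v. Proof. by case: N_equiv. Qed.
Let N_scale : forall (a : R) (v : X), N (a *: v) = `|a| * N v.
Proof. by case: N_equiv. Qed.
Let N_ge0 (v : X) : 0 <= N v. Proof. exact: seminorm_ge0. Qed.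

Context (e : nat -> X).
Hypothesis e_spreading : one_spreading N e.
Hypothesis e_schauder : schauder_basis e.
Hypothesis e_conditional : ~ unconditional e.

(** Averaging the translates by [t < P] turns the combination into the sum of the [b i] times the
    mean of [P] differences, whose norm is at least [eps]. *)
Lemma difference_average_lb (eps : R) (n : nat) (b : nat -> R) :
  (forall K, (0 < K)%N -> eps * K%:R <= difference_norm N e K) ->
  (forall i, 0 <= b i) ->
  eps * \sum_(i < n) b i <= N (\sum_(i < n) b i *: (e i.*2 - e i.*2.+1)).
Proof.
move=> hD b0; pose d i := e i.*2 - e i.*2.+1.
have hd j : N (d j) <= 2 * N (e 0%N).
  apply: le_trans (seminormB N_add N_scale _ _) _.
  by rewrite !(spreading_norm e_spreading) mulr_natl mulr2n.
apply: (@seminorm_const_le _ _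
  (\sum_(i < n) `|b i| * (i%:R * (2 * (2 * N (e 0%N)))))) => P P0.
have shift t : (t < P)%N -> N (0 + \sum_(i < n) b i *: d (i + t)%N)
    <= N (\sum_(i < n) b i *: d i).
  rewrite add0r -(@pair_spread _ _ N e e_spreading
    (fun i => (i + t).*2) (fun i => (i + t).*2.+1) b n) // => k; lia.
apply: le_trans (seminorm_translate_average N_add N_scale hd P0 shift).
rewrite add0r !N_scale ger0_norm ?sumr_ge0 // ger0_norm ?invr_ge0 // mulrC.
rewrite ler_wpM2l ?sumr_ge0 // ler_pdivlMl ?ltr0n // mulrC.
exact: hD.
Qed.

(* Otherwise the differences e_2k - e_{2k+1} would dominate l1, and hence so
   would (e_i) itself. *)
Lemma difference_norm_small (eps : R) : 0 < eps ->
  exists K, (0 < K)%N /\ difference_norm N e K <= eps * K%:R.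
Proof.
move=> eps0; apply: contrapT => hno.
have hD K : (0 < K)%N -> eps * K%:R <= difference_norm N e K.
  by move=> K0; rewrite leNgt; apply/negP => /ltW h; apply: hno; exists K.
apply: (basis_sign_fails N_equiv e_spreading e_schauder e_conditional
  (C := 4 / eps * N (e 0%N))) => n a s.
(* One factor 2 comes from making the coefficients of the pairs nonnegative, the other from
   splitting the differences into two spread copies of [lincomb e n a]. *)
have h1 : eps * \sum_(i < n) `|a i| <= 4 * N (lincomb e n a).
  apply: le_trans (difference_average_lb n hD (fun i => normr_ge0 (a i))) _.
  have := pair_sign N_add N_scale e_spreading a (fun i => a i < 0) n.
  under [X in N X <= _]eq_bigr do rewrite -normrEsign.
  have -> : \sum_(i < n) a i *: (e i.*2 - e i.*2.+1)
      = \sum_(i < n) a i *: e i.*2 - \sum_(i < n) a i *: e i.*2.+1.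
    by rewrite -sumrB; apply: eq_bigr => i _; rewrite scalerBr.
  have := seminormB N_add N_scale (\sum_(i < n) a i *: e i.*2)
    (\sum_(i < n) a i *: e i.*2.+1).
  rewrite (@spread_below _ _ _ _ e_spreading n double a); last by move=> i j; lia.
  rewrite (@spread_below _ _ _ _ e_spreading n (fun i => i.*2.+1) a); last first.
    by move=> i j; lia.
  lra.
have h2 : N (lincomb e n (fun i => (-1) ^+ s i * a i))
    <= (\sum_(i < n) `|a i|) * N (e 0%N).
  apply: le_trans (lincomb_le_mass N_add N_scale e_spreading n id
    (fun i => (-1) ^+ s i * a i)) _.
  by under eq_bigr do rewrite sign_mul_norm.
apply: le_trans h2 _; rewrite mulrAC ler_wpM2r //.
by rewrite mulrAC ler_pdivlMr // mulrC.
Qed.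

(** Cut the mass into [K] slices. Each has mass about [1 / K] and a coefficient sum that is a
    difference of two partial sums, so [core_estimate] bounds the norm by a multiple of
    [difference_norm K / K] plus a small error. *)
Lemma small_partial_sums (eta : R) : 0 < eta -> exists eta' : R, 0 < eta' /\
  forall n (a : nat -> R), \sum_(i < n) `|a i| = 1 ->
    (forall m, (m <= n)%N -> `|\sum_(i < m) a i| <= eta') ->
    N (lincomb e n a) <= eta.
Proof.
move=> eta0; have eta8 : 0 < eta / 8 by rewrite divr_gt0.
have [K [K0 hK]] := difference_norm_small eta8.
have K0' : 0 < K%:R :> R by rewrite ltr0n.
pose Ne := N (e 0%N).
have Ne0 : 0 <= Ne by apply: N_ge0.
(* The term [Ne] makes the error from the slice sums at most [eta / 2]; the term [eta] gives
   [2 * eta' <= 1 / K], so that a slice has mass at most [2 / K]. *)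
pose eta' := eta / (4 * K%:R * (Ne + eta + 1)).
have den0 : 0 < Ne + eta + 1 by lra.
have eta'0 : 0 < eta' by rewrite divr_gt0 // !mulr_gt0.
exists eta'; split => // n a a1 ha.
pose c i := if (i < n)%N then a i else 0.
have c0 i : 0 <= `|c i| by [].
have c_le i : `|c i| <= 2 * eta'.
  rewrite /c; case: ltnP => i_n; last by rewrite normr0; lra.
  have := ha _ i_n; have := ha _ (ltnW i_n); rewrite big_ord_recr /=.
  have := ler_normB (\sum_(j < i) a j + a i) (\sum_(j < i) a j).
  rewrite addrAC subrr add0r; lra.
have c1 : cumul (fun i => `|c i|) n = 1.
  by rewrite -a1; apply: eq_bigr => i _; rewrite /c ltn_ord.
pose kap := level (fun i => `|c i|) K.
have kap_mono : {homo kap : i j / (i <= j)%N} by apply: level_mono.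
(* The offset [i.+1] lies strictly between 0 and [B], so each index falls inside the slot of its
   slice. *)
pose B := n.+2; pose pos i := (B * kap i + i.+1)%N.
have pos_inc : increasing_below n pos.
  move=> i j ij jn; have := kap_mono _ _ (ltnW ij); rewrite /pos; nia.
have c_tail i : (i < n)%N -> ~~ (kap i < K)%N -> c i = 0.
  rewrite -leqNgt => i_n h; apply/eqP; rewrite -normr_eq0; apply/eqP.
  exact: (level_ge_null c0 K0 c1 i_n h).
have -> : N (lincomb e n a) = N (\sum_(i < n | (kap i < K)%N) c i *: e (pos i)).
  rewrite -(spread_below e_spreading a pos_inc) [in RHS]big_mkcond /=.
  congr N; apply: eq_bigr => i _.
  case: ifPn => [_|/c_tail h]; first by rewrite /c ltn_ord.
  by have := h (ltn_ord i); rewrite /c ltn_ord => ->; rewrite scale0r.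
have KeqM : K%:R * eta' = eta / (4 * (Ne + eta + 1)).
  by rewrite /eta'; field; rewrite !gt_eqF.
have beta_le : 2 * eta' <= K%:R^-1.
  rewrite -(ler_pM2l K0') mulfV ?gt_eqF // mulrCA KeqM mulrA ler_pdivrMr //; last lra.
  lra.
have beta0 : 0 < 2 * K%:R^-1 :> R by rewrite mulr_gt0 ?invr_gt0.
apply: (@le_trans _ _ (2 * (2 * K%:R^-1) * difference_norm N e K
  + K%:R * (2 * eta') * N (e 0%N))).
  apply: (@core_estimate _ _ _ N_add N_scale _ e_spreading 0 B K n
    (fun i => kap i < K)%N kap pos) => // [i i_n iK|k kK|k kK].
  - by rewrite iK /pos /B; apply/andP; split; nia.
  - apply: (@le_trans _ _ (K%:R^-1 + 2 * eta')).
      apply: le_trans (level_mass_ub c0 c_le K0 n k).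
      rewrite [leRHS]big_mkcond [leLHS]big_mkcond; apply: ler_sum => i _.
      by rewrite -/kap; case: (kap i == k); rewrite ?andbF //; case: ifP.
    by rewrite [leRHS]mulrDl mul1r lerD2l.
  - have -> : \sum_(i < n | (kap i < K)%N && (kap i == k)) c i
        = \sum_(i < n | kap i == k) c i.
      by apply: eq_bigl => i; case: eqP => [->|_]; rewrite ?kK ?andbF.
    have [m1 [m1n h1]] := below_level c0 n (k.+1%:R / K%:R).
    have [m2 [m2n h2]] := below_level c0 n (k%:R / K%:R).
    rewrite (level_sum c0 K0) h1 h2.
    have cE m : (m <= n)%N -> \sum_(i < m) c i = \sum_(i < m) a i.
      by move=> mn; apply: eq_bigr => i _; rewrite /c (leq_trans (ltn_ord i)).
    rewrite !cE //; apply: le_trans (ler_normB _ _) _.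
    have := ha _ m1n; have := ha _ m2n; lra.
have : 2 * (2 * K%:R^-1) * difference_norm N e K <= eta / 2.
  apply: (@le_trans _ _ (2 * (2 * K%:R^-1) * (eta / 8 * K%:R))).
    by rewrite ler_wpM2l // mulr_ge0 // ltW.
  rewrite le_eqVlt; apply/orP; left; apply/eqP; field.
  by rewrite gt_eqF.
have : K%:R * (2 * eta') * N (e 0%N) <= eta / 2.
  rewrite [K%:R * _]mulrCA KeqM -/Ne.
  have -> : 2 * (eta / (4 * (Ne + eta + 1))) * Ne = eta / 2 * (Ne / (Ne + eta + 1)).
    by field; rewrite gt_eqF.
  rewrite ler_piMr //; first by rewrite divr_ge0 // ltW.
  rewrite ler_pdivrMr //; lra.
lra.
Qed.

End SmallSums.

(** * Averages and the convex block homogeneous part *)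

Section Averages.
Context (R : realType) (X : completeNormedModType R) (N : X -> R).
Hypothesis N_equiv : equivalent_norm N.

Let N_add : forall u v : X, N (u + v) <= N u + N v. Proof. by case: N_equiv. Qed.
Let N_scale : forall (a : R) (v : X), N (a *: v) = `|a| * N v.
Proof. by case: N_equiv. Qed.
Let N_ge0 (v : X) : 0 <= N v. Proof. exact: seminorm_ge0. Qed.

Context (e : nat -> X).
Hypothesis e_spreading : one_spreading N e.
Hypothesis e_schauder : schauder_basis e.
Hypothesis e_conditional : ~ unconditional e.

Lemma level_class_bounds (mu : nat -> R) (delta : R) (n K k : nat) :
  (forall i, 0 <= mu i) -> (forall i, mu i <= delta) -> cumul mu n = 1 ->
  (0 < K)%N -> (k < K)%N ->
  K%:R^-1 - delta <= \sum_(i < n | level mu K i == k) mu i <= K%:R^-1 + delta.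
Proof.
move=> mu0 mu_le mu1 K0 kK; rewrite level_mass_ub // level_mass_lb // mu1.
by rewrite ler_pdivrMr ?ltr0n // mul1r ler_nat.
Qed.

(* The levels cut both weights into K slices of almost equal mass; the positions
   may be arbitrary as long as the slices are successive. *)
Definition near_average (K : nat) (delta eta : R) : Prop :=
  forall (lam lam' : nat -> R) (n n' B Q : nat) (pos pos' : nat -> nat),
    (forall i, 0 <= lam i <= delta) -> (forall i, 0 <= lam' i <= delta) ->
    cumul lam n = 1 -> cumul lam' n' = 1 -> (1 < B)%N ->
    (forall i, (i < n)%N ->
      (B * (Q + level lam K i) < pos i < B * (Q + level lam K i).+1)%N) ->
    (forall i, (i < n')%N ->
      (B * (Q + level lam' K i) < pos' i < B * (Q + level lam' K i).+1)%N) ->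
    N (\sum_(i < n) lam i *: e (pos i) - \sum_(i < n') lam' i *: e (pos' i))
      <= eta.

(** In the difference of the two vectors every slice has coefficient sum at most [2 * delta] and
    mass at most [4 / K], and [core_estimate] applies. *)
Lemma near_average_exists (eta : R) : 0 < eta ->
  exists (K : nat) (delta : R), 0 < delta /\ near_average K delta eta.
Proof.
move=> eta0; have eta16 : 0 < eta / 16 by rewrite divr_gt0.
have [K [K0 hK]] := difference_norm_small N_equiv e_spreading e_schauder
  e_conditional eta16.
have K0' : 0 < K%:R :> R by rewrite ltr0n.
pose Ne := N (e 0%N).
have Ne0 : 0 <= Ne by apply: N_ge0.
pose delta := eta / (4 * K%:R * (Ne + eta + 1)).
have den0 : 0 < Ne + eta + 1 by lra.
have delta0 : 0 < delta by rewrite divr_gt0 // !mulr_gt0.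
have Kdelta : K%:R * delta = eta / (4 * (Ne + eta + 1)).
  by rewrite /delta; field; rewrite !gt_eqF.
have delta_le : delta <= K%:R^-1.
  rewrite -(ler_pM2l K0') mulfV ?gt_eqF // Kdelta ler_pdivrMr //; last lra.
  lra.
exists K, delta; split => // lam lam' n n' B Q pos pos' hlam hlam' lam1 lam'1 B1
  hpos hpos'.
have [lam0 lam_le] : (forall i, 0 <= lam i) /\ (forall i, lam i <= delta).
  by split=> i; have /andP[] := hlam i.
have [lam'0 lam'_le] : (forall i, 0 <= lam' i) /\ (forall i, lam' i <= delta).
  by split=> i; have /andP[] := hlam' i.
(* The two families are concatenated, the second with opposite sign; corresponding levels fall into
   the same class and the same slot. *)
pose a i := if (i < n)%N then lam i else - lam' (i - n)%N.
pose kap i := if (i < n)%N then level lam K i else level lam' K (i - n).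
pose p i := if (i < n)%N then pos i else pos' (i - n)%N.
have lo (V : Type) (f g : nat -> V) (i : 'I_n) :
    (if (lshift n' i < n)%N then f (lshift n' i) else g (lshift n' i - n)%N) = f i.
  by rewrite /= ltn_ord.
have hi (V : Type) (f g : nat -> V) (i : 'I_n') :
    (if (rshift n i < n)%N then f (rshift n i) else g (rshift n i - n)%N) = g i.
  by rewrite /= ltnNge leq_addr /= addKn.
have sumE (V : zmodType) (f g : nat -> V) :
    \sum_(i < n + n') (if (i < n)%N then f i else g (i - n)%N)
    = \sum_(i < n) f i + \sum_(i < n') g i.
  rewrite big_split_ord; congr (_ + _); apply: eq_bigr => i _.
    exact: lo.
  exact: hi.
have sum_class (k : nat) (f : R -> R) :
    \sum_(i < n + n' | (kap i < K)%N && (kap i == k)) f (a i)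
    = if (k < K)%N then \sum_(i < n | level lam K i == k) f (lam i)
        + \sum_(i < n' | level lam' K i == k) f (- lam' i) else 0.
  rewrite (eq_bigl (fun i : 'I_(n + n') => (k < K)%N && (kap i == k))); last first.
    by move=> i; case: eqP => [->|_]; rewrite ?andbT ?andbF.
  case: (k < K)%N; last by rewrite big_pred0_eq.
  rewrite [LHS]big_mkcond [X in _ = X + _]big_mkcond [X in _ = _ + X]big_mkcond.
  rewrite -(sumE _ (fun i => if level lam K i == k then f (lam i) else 0)
    (fun i => if level lam' K i == k then f (- lam' i) else 0)).
  by apply: eq_bigr => i _; rewrite /kap /a /=; case: (i < n)%N.
have null : \sum_(i < n) lam i *: e (pos i) - \sum_(i < n') lam' i *: e (pos' i)
    = \sum_(i < n + n' | (kap i < K)%N) a i *: e (p i).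
  rewrite -sumrN [RHS]big_mkcond /=.
  rewrite -(sumE _ (fun i => lam i *: e (pos i)) (fun i => - (lam' i *: e (pos' i)))).
  apply: eq_bigr => i _; rewrite /kap /a /p; case: (ltnP i n) => i_n.
    case: ltnP => // h.
    by rewrite (level_ge_null lam0 K0 lam1 i_n h) scale0r.
  have i_n' : (i - n < n')%N by have := ltn_ord i; lia.
  case: ltnP => h; first by rewrite scaleNr.
  by rewrite (level_ge_null lam'0 K0 lam'1 i_n' h) scale0r oppr0.
rewrite null.
have beta0 : 0 < 4 * K%:R^-1 :> R by rewrite mulr_gt0 ?invr_gt0.
apply: (@le_trans _ _ (2 * (4 * K%:R^-1) * difference_norm N e K
  + K%:R * (2 * delta) * N (e 0%N))).
  apply: (@core_estimate _ _ _ N_add N_scale _ e_spreading Q B K (n + n')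
    (fun i => kap i < K)%N kap p) => // [i i_n iK|k kK|k kK].
  - rewrite iK /p /kap; case: (ltnP i n) => i_n2; first exact: hpos.
    by apply: hpos'; lia.
  - rewrite (sum_class k Num.norm) kK.
    under eq_bigr do rewrite (ger0_norm (lam0 _)).
    under [X in _ + X <= _]eq_bigr do rewrite normrN (ger0_norm (lam'0 _)).
    have /andP[_ h1] := level_class_bounds lam0 lam_le lam1 K0 kK.
    have /andP[_ h2] := level_class_bounds lam'0 lam'_le lam'1 K0 kK.
    move: (K%:R^-1) delta_le h1 h2 => ? ? ? ?; lra.
  - rewrite (sum_class k id) kK sumrN.
    have /andP[h1 h2] := level_class_bounds lam0 lam_le lam1 K0 kK.
    have /andP[h3 h4] := level_class_bounds lam'0 lam'_le lam'1 K0 kK.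
    rewrite ler_norml; move: (K%:R^-1) h1 h2 h3 h4 => ? ? ? ? ?; lra.
have : 2 * (4 * K%:R^-1) * difference_norm N e K <= eta / 2.
  apply: (@le_trans _ _ (2 * (4 * K%:R^-1) * (eta / 16 * K%:R))).
    by rewrite ler_wpM2l // mulr_ge0 // ltW.
  rewrite le_eqVlt; apply/orP; left; apply/eqP; field.
  by rewrite gt_eqF.
have : K%:R * (2 * delta) * N (e 0%N) <= eta / 2.
  rewrite [K%:R * _]mulrCA Kdelta -/Ne.
  have -> : 2 * (eta / (4 * (Ne + eta + 1))) * Ne = eta / 2 * (Ne / (Ne + eta + 1)).
    by field; rewrite gt_eqF.
  rewrite ler_piMr //; first by rewrite divr_ge0 // ltW.
  rewrite ler_pdivrMr //; lra.
lra.
Qed.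

(** Block [q] receives [(K q).+1] slots because its levels run from 0 to [K q], the last one being
    reached where the mass is 1. So different blocks never share a slot. *)
Lemma block_label_mono (J rho : nat -> nat) (w : nat -> nat -> R) (K : nat -> nat) :
  strictly_increasing J -> (forall i, (J (rho i) <= i < J (rho i).+1)%N) ->
  (forall r i, 0 <= w r i) -> (forall r i, cumul (w r) i <= 1) ->
  {homo (fun l => \sum_(q < rho l) (K q).+1
         + level (w (rho l)) (K (rho l)) (l - J (rho l)))%N : i j / (i <= j)%N}.
Proof.
move=> J_inc rhoP w0 w1 i j ij; have := label_mono J_inc rhoP ij.
rewrite leq_eqVlt => /orP[/eqP <-|h].
  by rewrite leq_add2l; apply: level_mono => //; rewrite leq_sub2r.
apply: (@leq_trans (\sum_(q < (rho i).+1) (K q).+1)).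
  rewrite big_ord_recr /= leq_add2l; apply: leqW.
  by rewrite /level -[leqRHS](@natrK R) le_truncn // ler_piMr.
apply: leq_trans (leq_addr _ _); rewrite -!(big_mkord xpredT (fun q => (K q).+1)).
by rewrite [leqRHS](@big_cat_nat _ _ _ (rho i).+1) //= leq_addr.
Qed.

End Averages.

(** * Comparison of convex blocks with long averages *)

Section Comparison.
Context (R : realType) (X : completeNormedModType R) (N : X -> R).
Hypothesis N_equiv : equivalent_norm N.

Let N_add : forall u v : X, N (u + v) <= N u + N v. Proof. by case: N_equiv. Qed.
Let N_scale : forall (a : R) (v : X), N (a *: v) = `|a| * N v.
Proof. by case: N_equiv. Qed.
Let N_ge0 (v : X) : 0 <= N v. Proof. exact: seminorm_ge0. Qed.

Context (e : nat -> X).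
Hypothesis e_spreading : one_spreading N e.

(** Extended by 0 past the end of the block, since [near_average] bounds the weights at every
    index. *)
Definition block_weights (J : nat -> nat) (lam : nat -> R) (r i : nat) : R :=
  if (i < J r.+1 - J r)%N then lam (J r + i)%N else 0.

Lemma block_weights_cumul (J : nat -> nat) (lam : nat -> R) (r : nat) :
  strictly_increasing J -> \sum_(J r <= l < J r.+1) lam l = 1 ->
  cumul (block_weights J lam r) (J r.+1 - J r) = 1.
Proof.
move=> J_inc <-; have JJ : (J r <= J r.+1)%N by rewrite ltnW ?J_inc.
rewrite -{2}(subnKC JJ) sum_translate; apply: eq_bigr => i _.
by rewrite /block_weights ltn_ord.
Qed.

Lemma block_weights_cumul_le (J : nat -> nat) (lam : nat -> R) (r i : nat) :
  strictly_increasing J -> (forall l, 0 <= lam l) ->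
  \sum_(J r <= l < J r.+1) lam l = 1 ->
  cumul (block_weights J lam r) i <= 1.
Proof.
move=> J_inc lam0 h1; rewrite -(block_weights_cumul J_inc h1).
have w0 j : 0 <= block_weights J lam r j by rewrite /block_weights; case: ifP.
case: (leqP i (J r.+1 - J r)) => h; first exact: cumul_mono.
rewrite -(subnKC (ltnW h)) /cumul big_split_ord /= [X in _ + X]big1 ?addr0 //.
by move=> j _; rewrite /block_weights /= ltnNge leq_addr.
Qed.

Definition block_position (J : nat -> nat) (lam : nat -> R) (K : nat -> nat)
    (B off r i : nat) : nat :=
  (B * (\sum_(q < r) (K q).+1 + level (block_weights J lam r) (K r) i)
    + (off + (J r + i)).+1)%N.

(** Moving the indices into the slots of their block and level keeps their order, so spreading
    preserves the norm. *)
Lemma spread_to_block_positions (J m : nat -> nat) (lam : nat -> R)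
    (K : nat -> nat) (B off n : nat) (a : nat -> R) :
  strictly_increasing J -> J 0%N = 0%N -> strictly_increasing m ->
  (forall l, 0 <= lam l) -> (forall r, \sum_(J r <= l < J r.+1) lam l = 1) ->
  N (\sum_(r < n) a r *: \sum_(J r <= l < J r.+1) lam l *: e (m l))
  = N (\sum_(r < n) a r *: \sum_(i < J r.+1 - J r)
      block_weights J lam r i *: e (block_position J lam K B off r i)).
Proof.
move=> J_inc J0 m_inc lam0 lam1.
have [rho rhoP] := label_exists J_inc J0.
have w0 r i : 0 <= block_weights J lam r i by rewrite /block_weights; case: ifP.
have w1 r i := block_weights_cumul_le i J_inc lam0 (lam1 r).
pose kap l := (\sum_(q < rho l) (K q).+1
  + level (block_weights J lam (rho l)) (K (rho l)) (l - J (rho l)))%N.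
have kap_mono : {homo kap : i j / (i <= j)%N} by apply: block_label_mono.
pose p l := (B * kap l + (off + l).+1)%N.
have p_inc : increasing_below (J n) p.
  move=> i j ij _; have := kap_mono _ _ (ltnW ij); rewrite /p => h.
  by have := leq_mul (leqnn B) h; lia.
under eq_bigr do rewrite scaler_sumr.
rewrite -(sum_label J_inc rhoP J0 (fun r l => a r *: (lam l *: e (m l)))).
under eq_bigr do rewrite scalerA.
rewrite (@spread_below_eq _ _ _ _ e_spreading (J n) m p
  (fun l => a (rho l) * lam l) (strictly_increasing_below m_inc) p_inc).
congr N; rewrite (sum_label J_inc rhoP J0 (fun r l => (a r * lam l) *:
  e (B * (\sum_(q < r) (K q).+1
    + level (block_weights J lam r) (K r) (l - J r)) + (off + l).+1)%N)).
apply: eq_bigr => r _.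
have JJ : (J r <= J r.+1)%N by rewrite ltnW ?J_inc.
rewrite -{1}(subnKC JJ) sum_translate scaler_sumr; apply: eq_bigr => i _.
by rewrite addKn scalerA /block_weights ltn_ord.
Qed.

Lemma average_compare (J m : nat -> nat) (lam : nat -> R) (K : nat -> nat)
    (delta eta : nat -> R) (n M : nat) (a : nat -> R) :
  strictly_increasing J -> J 0%N = 0%N -> strictly_increasing m ->
  (forall l, 0 <= lam l) -> (forall r, \sum_(J r <= l < J r.+1) lam l = 1) ->
  (forall r, near_average N e (K r) (delta r) (eta r)) ->
  (forall r, 0 <= delta r) ->
  (forall r l, (J r <= l < J r.+1)%N -> lam l <= delta r) ->
  (0 < M)%N -> (forall r, (r < n)%N -> M%:R^-1 <= delta r) ->
  `|N (\sum_(r < n) a r *: \sum_(J r <= l < J r.+1) lam l *: e (m l))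
    - N (lincomb (average e M) n a)| <= \sum_(r < n) `|a r| * eta r.
Proof.
move=> J_inc J0 m_inc lam0 lam1 near delta0 lam_le M0 hM.
have M0' : 0 < M%:R :> R by rewrite ltr0n.
(* The averages are convex blocks with constant weights. Both combinations are moved into the same
   slots, where [near_average] compares them block by block. *)
pose J' r := (r * M)%N; pose lam' (l : nat) : R := M%:R^-1.
have J'_inc : strictly_increasing J' by move=> i j ij; rewrite /J' ltn_pmul2r.
have J'0 : J' 0%N = 0%N by [].
have J'S r : (J' r.+1 - J' r = M)%N by rewrite /J' mulSn addnK.
have lam'0 l : 0 <= lam' l by rewrite /lam' invr_ge0.
have lam'1 r : \sum_(J' r <= l < J' r.+1) lam' l = 1.
  by rewrite sumr_const_nat J'S -[_ *+ _]mulr_natl mulfV ?gt_eqF.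
have -> : lincomb (average e M) n a
    = \sum_(r < n) a r *: \sum_(J' r <= l < J' r.+1) lam' l *: e l.
  by apply: eq_bigr => r _; rewrite /average -scaler_sumr.
(* Slots of this length hold the offsets of both families. *)
pose B := (J n + J' n).+2.
rewrite (spread_to_block_positions K B 0 n a J_inc J0 m_inc lam0 lam1).
have id_inc : strictly_increasing id by [].
rewrite (spread_to_block_positions K B (J n) n a J'_inc J'0 id_inc lam'0 lam'1).
set U := \sum_(r < n) _; set V := \sum_(r < n) _.
apply: (@le_trans _ _ (N (U - V))).
  rewrite ler_norml; apply/andP; split.
    have := seminorm_le_dist N_add V U; rewrite (seminorm_distC N_scale); lra.
  have := seminorm_le_dist N_add U V; lra.
rewrite /U /V -sumrB.
apply: le_trans (seminorm_sum N_add N_scale _ _ _) _; apply: ler_sum => r _.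
rewrite -scalerBr N_scale ler_wpM2l //.
have bw0 (Jr : nat -> nat) l0 q i : (forall l, 0 <= l0 l) ->
    0 <= block_weights Jr l0 q i by move=> h; rewrite /block_weights; case: ifP.
have rn := ltn_ord r.
apply: (near r _ _ _ _ B (\sum_(q < r) (K q).+1)%N) => //.
- move=> i; rewrite bw0 //= /block_weights; case: ltnP => h //.
  by apply: (lam_le r); lia.
- move=> i; rewrite bw0 //= /block_weights; case: ltnP => h //.
  exact: hM.
- exact: block_weights_cumul.
- exact: block_weights_cumul.
- move=> i hi; rewrite /block_position; set q := (\sum_(_ < _) _ + _)%N.
  have := leq_strictly_increasing J_inc rn; rewrite /B mulnS; lia.
- move=> i hi; rewrite /block_position; set q := (\sum_(_ < _) _ + _)%N.
  have := leq_strictly_increasing J'_inc rn; rewrite /B mulnS; lia.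
Qed.

Context (Z : completeNormedModType R) (z : nat -> Z).
Hypothesis z_limit : forall (n : nat) (a : nat -> R),
  (fun m : nat => N (lincomb (average e m) n a)) @ \oo --> `|lincomb z n a|.

(** Let the length [M] of the averages in [average_compare] tend to infinity; the finitely many
    conditions on [M] hold from some point on. *)
Lemma homogeneous_compare (J m : nat -> nat) (lam : nat -> R) (K : nat -> nat)
    (delta eta : nat -> R) (n : nat) (a : nat -> R) :
  strictly_increasing J -> J 0%N = 0%N -> strictly_increasing m ->
  (forall l, 0 <= lam l) -> (forall r, \sum_(J r <= l < J r.+1) lam l = 1) ->
  (forall r, near_average N e (K r) (delta r) (eta r)) ->
  (forall r, 0 < delta r) ->
  (forall r l, (J r <= l < J r.+1)%N -> lam l <= delta r) ->
  `|N (\sum_(r < n) a r *: \sum_(J r <= l < J r.+1) lam l *: e (m l))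
    - `|lincomb z n a| | <= \sum_(r < n) `|a r| * eta r.
Proof.
move=> J_inc J0 m_inc lam0 lam1 near delta0 lam_le.
apply/ler_addgt0Pr => eps eps0.
have [n1 hn1] := (cvg_seqP _ _).1 (@z_limit n a) _ eps0.
have [n2 hn2] : exists n2, forall M, (n2 <= M)%N ->
    forall r, (r < n)%N -> M.+1%:R^-1 <= delta r.
  elim: n {a hn1} => [|n [k hk]]; first by exists 0%N.
  have [k' hk'] := inv_natS_lt (delta0 n); exists (maxn k k') => M.
  rewrite geq_max => /andP[kM k'M] r; rewrite ltnS leq_eqVlt => /orP[/eqP ->|rn].
    by rewrite ltW ?hk'.
  exact: hk.
pose M := (maxn n1 n2).
have h1 := hn1 M.+1 (leqW (leq_maxl _ _)).
have delta0' r : 0 <= delta r by apply: ltW.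
have h2 := average_compare a J_inc J0 m_inc lam0 lam1 near delta0' lam_le (ltn0Sn M)
  (hn2 M (leq_maxr _ _)).
apply: le_trans (ler_distD (N (lincomb (average e M.+1) n a)) _ _) _.
by apply: lerD h2 (ltW h1).
Qed.

Lemma average_partial (C : R) (n q M : nat) (a : nat -> R) :
  (forall n m (a : nat -> R), (m <= n)%N ->
    `|\sum_(i < m) a i| <= C * N (lincomb e n a)) ->
  (q <= n)%N -> (0 < M)%N ->
  `|\sum_(r < q) a r| <= C * N (lincomb (average e M) n a).
Proof.
move=> hC qn M0; pose J r := (r * M)%N.
have J_inc : strictly_increasing J by move=> i j ij; rewrite /J ltn_pmul2r.
have J0 : J 0%N = 0%N by [].
have [rho rhoP] := label_exists J_inc J0.
have JS r : (J r.+1 - J r = M)%N by rewrite /J mulSn addnK.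
have -> : lincomb (average e M) n a
    = lincomb e (J n) (fun l => a (rho l) * M%:R^-1).
  rewrite /lincomb (sum_label J_inc rhoP J0 (fun r l => (a r * M%:R^-1) *: e l)).
  by apply: eq_bigr => r _; rewrite /average scalerA scaler_sumr.
have -> : \sum_(r < q) a r = \sum_(l < J q) a (rho l) * M%:R^-1.
  rewrite (sum_label J_inc rhoP J0 (fun r l => a r * M%:R^-1)).
  apply: eq_bigr => r _; rewrite sumr_const_nat JS -mulrnAr -[_ *+ _]mulr_natl.
  by rewrite mulfV ?mulr1 // pnatr_eq0 -lt0n.
by apply: hC; rewrite leq_mul2r qn orbT.
Qed.

(** Partial sums of [a] are partial sums of the expansion of a combination of averages, so their
    bound passes to the limit norm. A coefficient is a difference of two of them. *)
Lemma homogeneous_coef (C : R) : 0 < C ->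
  (forall n m (a : nat -> R), (m <= n)%N ->
    `|\sum_(i < m) a i| <= C * N (lincomb e n a)) ->
  forall n k (a : nat -> R), (k < n)%N -> `|a k| <= 2 * C * `|lincomb z n a|.
Proof.
move=> C0 hC n k a kn.
have partial q : (q <= n)%N -> `|\sum_(r < q) a r| <= C * `|lincomb z n a|.
  move=> qn; apply/ler_addgt0Pr => eps eps0.
  have [n1 /(_ n1.+1 (leqnSn _)) hn1] := (cvg_seqP _ _).1 (@z_limit n a) _
    (divr_gt0 eps0 C0).
  apply: le_trans (average_partial a hC qn (ltn0Sn n1)) _.
  rewrite -[eps in leRHS](divfK (lt0r_neq0 C0)) [_ / C * C]mulrC -mulrDr.
  rewrite ler_pM2l //.
  move: hn1; set A := N _; set L := `|lincomb z n a| => hn1.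
  have := ler_norm (A - L); lra.
have := partial _ kn; rewrite big_ord_recr /=.
have := partial _ (ltnW kn).
have := ler_normB (\sum_(r < k) a r + a k) (\sum_(r < k) a r).
rewrite addrAC subrr add0r; lra.
Qed.

End Comparison.

(** * Block sequences *)

(** The supports are enlarged to consecutive intervals, each ending at the maximum of its [F k],
    with coefficient 0 in the gaps. Since [G] takes values in any module, the same data serve for
    the block vectors and for their coefficient sums. *)
Lemma block_normal_form (R : realType) (F : nat -> {fset nat}) (c : nat -> R) :
  successive F -> (forall k, exists i, i \in F k) ->
  exists (b : nat -> nat) (C : nat -> R),
  [/\ strictly_increasing b, b 0%N = 0%N &
    forall k (V : lmodType R) (G : nat -> V),
      \sum_(i <- F k) c i *: G i = \sum_(b k <= i < b k.+1) C i *: G i].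
Proof.
move=> F_succ F_ne.
pose b k := if k is j.+1 then (\max_(i <- F j) i).+1 else 0%N.
have b_ub k i : i \in F k -> (i < b k.+1)%N.
  by move=> iF; rewrite /b ltnS; exact: (@leq_bigmax_seq nat (enum_fset (F k)) xpredT id i iF isT).
have b_lb k i : i \in F k -> (b k <= i)%N.
  case: k => [//|k] iF; rewrite /b.
  have [j jF] := F_ne k.
  apply: (@leq_ltn_trans i.-1); last by have := F_succ k k.+1 j i (ltnSn k) jF iF; lia.
  apply/bigmax_leqP_seq => t tF _.
  by have := F_succ k k.+1 t i (ltnSn k) tF iF; lia.
have b_inc : strictly_increasing b.
  apply: homo_ltn => [? ? ?|k]; first exact: ltn_trans.
  by have [i iF] := F_ne k; apply: leq_ltn_trans (b_lb _ _ iF) (b_ub _ _ iF).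
have b0 : b 0%N = 0%N by [].
have [kap kapP] := label_exists b_inc b0.
exists b, (fun i => if i \in F (kap i) then c i else 0); split=> // k V G.
rewrite (eq_big_nat _ _ (F2 := fun i => if i \in F k then c i *: G i else 0)).
  rewrite -big_mkcond -big_filter; apply: perm_big; apply: uniq_perm.
  - exact: fset_uniq.
  - by rewrite filter_uniq // iota_uniq.
  - move=> i; rewrite mem_filter mem_index_iota.
    by case iF : (i \in F k) => //=; rewrite b_ub ?b_lb.
move=> i hi; rewrite (label_uniq b_inc kapP hi).
by case: ifP; rewrite ?scale0r.
Qed.

Section Blocks.
Context (R : realType) (X : completeNormedModType R) (N : X -> R).
Hypothesis N_equiv : equivalent_norm N.

Let N_add : forall u v : X, N (u + v) <= N u + N v. Proof. by case: N_equiv. Qed.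
Let N_scale : forall (a : R) (v : X), N (a *: v) = `|a| * N v.
Proof. by case: N_equiv. Qed.
Let N_ge0 (v : X) : 0 <= N v. Proof. exact: seminorm_ge0. Qed.

Context (e : nat -> X).
Hypothesis e_spreading : one_spreading N e.
Context (b : nat -> nat) (C : nat -> R).
Hypothesis b_inc : strictly_increasing b.
Hypothesis b0 : b 0%N = 0%N.

Definition block (r : nat) : X := \sum_(b r <= i < b r.+1) C i *: e i.
Definition block_sum (r : nat) : R := \sum_(b r <= i < b r.+1) C i.
(** The correction sits at the first index of the interval, so the supports stay successive. *)
Definition centered_block (r : nat) : X := block r - block_sum r *: e (b r).

Lemma lincomb_block (n : nat) (a : nat -> R) (rho : nat -> nat) :
  (forall i, (b (rho i) <= i < b (rho i).+1)%N) ->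
  lincomb block n a = lincomb e (b n) (fun i => a (rho i) * C i).
Proof.
move=> rhoP; rewrite /lincomb (sum_label b_inc rhoP b0
  (fun r i => (a r * C i) *: e i)); apply: eq_bigr => r _.
by rewrite /block scaler_sumr; apply: eq_bigr => i _; rewrite scalerA.
Qed.

Lemma block_partial_sums (D : R) (n m : nat) (a : nat -> R) :
  (forall n m (a : nat -> R), (m <= n)%N ->
    `|\sum_(i < m) a i| <= D * N (lincomb e n a)) ->
  (m <= n)%N ->
  `|\sum_(r < m) a r * block_sum r| <= D * N (lincomb block n a).
Proof.
move=> hD mn; have [rho rhoP] := label_exists b_inc b0.
rewrite (lincomb_block n a rhoP).
have -> : \sum_(r < m) a r * block_sum r = \sum_(i < b m) a (rho i) * C i.
  rewrite (sum_label b_inc rhoP b0 (fun r i => a r * C i)).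
  by apply: eq_bigr => r _; rewrite mulr_sumr.
apply: hD; exact: leq_strictly_increasing.
Qed.

Lemma centered_block_coefs : exists (rho : nat -> nat) (C' : nat -> R),
  [/\ {homo rho : i j / (i <= j)%N},
    (forall n k (a : nat -> R), \sum_(i < b n | rho i == k) a (rho i) * C' i = 0) &
    forall n (a : nat -> R), lincomb centered_block n a
      = lincomb e (b n) (fun i => a (rho i) * C' i)].
Proof.
have [rho rhoP] := label_exists b_inc b0.
pose C' i := C i - (if i == b (rho i) then block_sum (rho i) else 0).
have bS r : (b r < b r.+1)%N by apply: b_inc.
(* Used with [G] constant 1 for the vanishing sums and with [G] equal to [e] for the vectors. *)
have sumE (V : lmodType R) (G : nat -> V) r :
    \sum_(b r <= i < b r.+1) C' i *: G i
    = \sum_(b r <= i < b r.+1) C i *: G i - block_sum r *: G (b r).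
  rewrite (eq_big_nat _ _ (F2 := fun i => C i *: G i
    - (if i == b r then block_sum r *: G (b r) else 0))); last first.
    move=> i hi; rewrite /C' (label_uniq b_inc rhoP hi) scalerBl.
    by case: eqP => [->|_]; rewrite ?scale0r.
  rewrite sumrB; congr (_ - _); rewrite big_ltn // eqxx big_nat big1 ?addr0 //.
  by move=> i /andP[hi _]; rewrite gtn_eqF.
exists rho, C'; split; first exact: label_mono b_inc rhoP.
- move=> n k a; rewrite (sum_label_class b_inc rhoP b0
    (fun i => a (rho i) * C' i)); case: ifP => // _.
  rewrite (eq_big_nat _ _ (F2 := fun i => a k * C' i)); last first.
    by move=> i hi; rewrite (label_uniq b_inc rhoP hi).
  rewrite -mulr_sumr; have := sumE R^o (fun=> 1) k; rewrite /=.
  under eq_bigr do rewrite [_ *: _]mulr1.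
  move=> ->; under eq_bigr do rewrite [_ *: _]mulr1.
  by rewrite [_ *: _]mulr1 subrr mulr0.
- move=> n a; rewrite /lincomb (sum_label b_inc rhoP b0
    (fun r i => (a r * C' i) *: e i)); apply: eq_bigr => r _.
  rewrite /centered_block /block -(sumE X e r) scaler_sumr.
  by apply: eq_bigr => i _; rewrite scalerA.
Qed.

Lemma centered_block_sign (n : nat) (a : nat -> R) (s : nat -> bool) :
  N (lincomb centered_block n (fun r => (-1) ^+ s r * a r))
    <= 2 * N (lincomb centered_block n a).
Proof.
have [rho [C' [rho_mono zero_sum lincombE]]] := centered_block_coefs.
rewrite !lincombE.
have -> : lincomb e (b n) (fun i => (-1) ^+ s (rho i) * a (rho i) * C' i)
    = lincomb e (b n) (fun i => (-1) ^+ s (rho i) * (a (rho i) * C' i)).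
  by apply: eq_bigr => i _; rewrite mulrA.
apply: (@sign_blocks _ _ _ N_add N_scale _ e_spreading rho (b n)
  (fun i => a (rho i) * C' i) s rho_mono) => k.
exact: zero_sum.
Qed.

(** All the other blocks have zero sum and can be suppressed. *)
Lemma centered_block_coef (n k : nat) (a : nat -> R) : (k < n)%N ->
  `|a k| * N (centered_block k) <= N (lincomb centered_block n a).
Proof.
move=> kn; have [rho [C' [rho_mono zero_sum lincombE]]] := centered_block_coefs.
have -> : `|a k| * N (centered_block k)
    = N (lincomb centered_block n (fun r => if r == k then a r else 0)).
  rewrite -N_scale; congr N; rewrite /lincomb (bigD1 (Ordinal kn)) //= eqxx.
  rewrite big1 ?addr0 // => r; rewrite -val_eqE /= => /negbTE ->.
  by rewrite scale0r.
rewrite !lincombE.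
have := @suppress_labels _ _ _ N_add N_scale _ e_spreading rho (b n)
  (fun i => a (rho i) * C' i) (predC1 k) rho_mono (fun q _ => zero_sum n q a).
apply: le_trans.
rewrite le_eqVlt; apply/orP; left; apply/eqP; congr N; apply: eq_bigr => i _ /=.
by case: eqP => //=; rewrite mul0r.
Qed.

Lemma lincomb_centered (n : nat) (a : nat -> R) :
  lincomb block n a = lincomb centered_block n a
    + \sum_(r < n) (a r * block_sum r) *: e (b r).
Proof.
rewrite /lincomb -big_split; apply: eq_bigr => r _ /=.
by rewrite /centered_block scalerBr scalerA subrK.
Qed.

(* With small sums the blocks are a small perturbation of their centered
   versions, whose successive zero-sum supports make them unconditional. *)
Lemma small_sums_unconditional (c : R) :
  0 < c -> (forall k, c <= N (block k)) ->
  (forall n, \sum_(r < n) `|block_sum r| * N (e 0%N) <= c / 4) ->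
  unconditional block.
Proof.
move=> c0 hc hsum.
have y_ge k : c / 2 <= N (centered_block k).
  have h1 : `|block_sum k| * N (e 0%N) <= c / 4.
    apply: le_trans (hsum k.+1); rewrite big_ord_recr /= lerDr.
    by apply: sumr_ge0 => i _; rewrite mulr_ge0.
  have := N_add (centered_block k) (block_sum k *: e (b k)); rewrite subrK.
  rewrite N_scale (spreading_norm e_spreading); have := hc k; lra.
have close n (a : nat -> R) : N (\sum_(r < n) (a r * block_sum r) *: e (b r))
    <= 2^-1 * N (lincomb centered_block n a).
  set Y := N (lincomb _ _ _).
  have Y0 : 0 <= Y by apply: N_ge0.
  apply: (@le_trans _ _ (\sum_(r < n) (2 / c * Y) * (`|block_sum r| * N (e 0%N)))).
    apply: le_trans (seminorm_sum N_add N_scale _ _ _) _; apply: ler_sum => r _.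
    rewrite N_scale (spreading_norm e_spreading) normrM -[leLHS]mulrA.
    apply: ler_wpM2r; first by rewrite mulr_ge0.
    rewrite -(ler_pM2r (_ : 0 < c / 2)) ?divr_gt0 //.
    have -> : 2 / c * Y * (c / 2) = Y by field; rewrite gt_eqF.
    apply: le_trans (centered_block_coef a (ltn_ord r)).
    by rewrite ler_wpM2l.
  rewrite -mulr_sumr; apply: le_trans (ler_wpM2l _ (hsum n)) _.
    by rewrite mulr_ge0 // divr_ge0 // ltW.
  by rewrite le_eqVlt; apply/orP; left; apply/eqP; field; rewrite gt_eqF.
(* Passing from centered blocks to blocks costs a factor [3 / 2], the sign change 2, and the way
   back from blocks to centered blocks 2. *)
apply: (equivalent_norm_unconditional N_equiv c0 hc (C := 6)) => n a s.
rewrite !lincomb_centered.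
have := centered_block_sign n a s.
have := close n a; have := close n (fun i => (-1) ^+ s i * a i).
set Y' := lincomb _ _ _; set Y := lincomb _ _ a.
set S' := \sum_(r < n) _; set S := \sum_(r < n) _ => h1 h2 h3.
have := N_add Y' S'; have := N_add (Y + S) (- S); rewrite addrK (seminormN N_scale).
have := N_ge0 Y; lra.
Qed.

End Blocks.

(** * Subsequences and nearly null combinations *)

Lemma bounded_cluster (R : realType) (u : nat -> R) (C : R) :
  (forall k, `|u k| <= C) ->
  exists l : R, forall (eps : R) (k : nat), 0 < eps ->
    exists j, (k <= j)%N /\ `|u j - l| <= eps.
Proof.
move=> hu; have := @segment_compact R (- C) C.
move=> /(_ (u @ \oo) _)[|l [_ hl]].
  by exists 0%N => // k _ /=; rewrite in_itv /= -ler_norml hu.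
exists l => eps k eps0.
have [|y [/= [j kj <-]]] := hl [set u j | j in [set j | (k <= j)%N]] _ _
    (nbhsx_ballx l eps eps0).
  by exists k => // j kj /=; exists j.
by rewrite -ball_normE /= => h; exists j; rewrite distrC ltW.
Qed.

Lemma fast_subsequence (R : realType) (u eps : nat -> R) (l : R) :
  (forall k, 0 < eps k) ->
  (forall (eps : R) (k : nat), 0 < eps ->
    exists j, (k <= j)%N /\ `|u j - l| <= eps) ->
  exists phi : nat -> nat, strictly_increasing phi /\
    forall k, `|u (phi k) - l| <= eps k.
Proof.
move=> eps0 hl.
have /choice[g hg] (p : nat * nat) :
  exists j, (p.2 <= j)%N /\ `|u j - l| <= eps p.1 by apply: hl.
pose phi := fix phi k :=
  if k is k'.+1 then g (k, (phi k').+1) else g (0%N, 0%N).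
exists phi; split.
  by apply: homo_ltn => [? ? ?|k]; [exact: ltn_trans | have [] := hg (k.+1, (phi k).+1)].
by case=> [|k]; [have [] := hg (0%N, 0%N) | have [] := hg (k.+1, (phi k).+1)].
Qed.

Lemma geometric_sum_le (R : realType) (n : nat) :
  \sum_(k < n) 2^-1 ^+ k.+1 <= 1 :> R.
Proof.
suff -> : \sum_(k < n) 2^-1 ^+ k.+1 = 1 - 2^-1 ^+ n :> R.
  by rewrite gerBl exprn_ge0.
elim: n => [|n ih]; first by rewrite big_ord0 expr0 subrr.
by rewrite big_ord_recr /= ih exprS; field.
Qed.

Section Steps.
Context (R : realType) (X : completeNormedModType R) (N : X -> R).
Hypothesis N_equiv : equivalent_norm N.

Let N_add : forall u v : X, N (u + v) <= N u + N v. Proof. by case: N_equiv. Qed.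
Let N_scale : forall (a : R) (v : X), N (a *: v) = `|a| * N v.
Proof. by case: N_equiv. Qed.
Let N_ge0 (v : X) : 0 <= N v. Proof. exact: seminorm_ge0. Qed.

(** Otherwise the tail of [x] from [J] on dominates l1 with constant [eps]; being bounded by [D], it
    satisfies a sign inequality and is an unconditional subsequence. *)
Lemma not_l1_tail (x : nat -> X) (c D eps : R) (J : nat) :
  0 < c -> (forall k, c <= N (x k)) -> (forall k, N (x k) <= D) ->
  ~ (exists phi : nat -> nat, strictly_increasing phi /\ unconditional (x \o phi)) ->
  0 < eps ->
  exists n (a : nat -> R), [/\ (J < n)%N, forall j, (j < J)%N -> a j = 0,
    \sum_(j < n) `|a j| = 1 & N (lincomb x n a) <= eps].
Proof.
move=> c0 hc hD hno eps0; apply: contrapT => hno2; apply: hno.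
exists (addn J); split; first by move=> i j; rewrite ltn_add2l.
have D0 : 0 <= D by apply: le_trans (hD 0%N); exact: N_ge0.
have lower n (a : nat -> R) : eps * \sum_(j < n) `|a j| <= N (lincomb (x \o addn J) n a).
  set S := \sum_(j < n) _; rewrite leNgt; apply/negP => h.
  have S0 : 0 < S.
    by rewrite -(pmulr_rgt0 _ eps0); apply: le_lt_trans h; exact: N_ge0.
  have n0 : (0 < n)%N.
    by case: n @S S0 {h} => // S; rewrite /S big_ord0 ltxx.
  pose a' j := if (j < J)%N then 0 else S^-1 * a (j - J)%N.
  have lo j : (J + j < J)%N = false by rewrite ltnNge leq_addr.
  apply: hno2; exists (J + n)%N, a'; split.
  - by rewrite -[ltnLHS]addn0 ltn_add2l.
  - by move=> j jJ; rewrite /a' jJ.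
  - rewrite big_split_ord /= big1 ?add0r => [|i _]; last by rewrite /a' ltn_ord normr0.
    under eq_bigr do rewrite /a' /= lo addKn normrM.
    by rewrite -mulr_sumr gtr0_norm ?invr_gt0 // mulVf ?gt_eqF.
  - have -> : lincomb x (J + n) a' = S^-1 *: lincomb (x \o addn J) n a.
      rewrite /lincomb big_split_ord /= big1 ?add0r => [|i _]; last first.
        by rewrite /a' ltn_ord scale0r.
      rewrite scaler_sumr; apply: eq_bigr => i _.
      by rewrite /a' /= lo addKn scalerA.
    rewrite N_scale gtr0_norm ?invr_gt0 // ler_pdivrMl // mulrC ltW //.
apply: (equivalent_norm_unconditional N_equiv c0 _ (C := D / eps)) => [k|n a s].
  exact: hc.
apply: (@le_trans _ _ (D * \sum_(j < n) `|a j|)).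
  apply: le_trans (seminorm_sum N_add N_scale _ _ _) _; rewrite mulr_sumr.
  apply: ler_sum => i _; rewrite N_scale sign_mul_norm mulrC ler_wpM2r //.
  exact: hD.
by rewrite mulrAC ler_pdivlMr // -mulrA ler_wpM2l // mulrC.
Qed.

Context (e : nat -> X).
Hypothesis e_spreading : one_spreading N e.
Hypothesis e_schauder : schauder_basis e.
Hypothesis e_conditional : ~ unconditional e.

(** As the block sums are close to [s], the partial sums of [a] are controlled by those of the
    expansion of the small vector. So the part carried by the [e (b r)] is small, hence so is the
    centered part, whose signs may be changed to those of the absolute values. *)
Lemma nearly_null_step (s delta : R) : s != 0 -> 0 < delta ->
  exists eps : R, 0 < eps /\
  forall (b : nat -> nat) (C : nat -> R) (n : nat) (a : nat -> R),
    strictly_increasing b -> b 0%N = 0%N ->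
    (forall r, (r < n)%N -> a r != 0 -> `|block_sum b C r - s| <= eps) ->
    \sum_(r < n) `|a r| = 1 -> N (lincomb (block e b C) n a) <= eps ->
    (forall r, (r < n)%N -> `|a r| <= delta) /\
    N (\sum_(r < n) `|a r| *: (block e b C r - s *: e (b r))) <= delta.
Proof.
rewrite -normr_gt0 => s0 delta0; pose Ne := N (e 0%N).
have Ne0 : 0 <= Ne by apply: N_ge0.
have [D [D0 hD]] := partial_sums_bounded N_equiv e_spreading e_schauder e_conditional.
have eta0 : 0 < delta / (4 * `|s|) by rewrite divr_gt0 // mulr_gt0.
set eta := delta / _ in eta0.
have [eta' [eta'0 hOmega]] := small_partial_sums N_equiv e_spreading e_schauder
  e_conditional eta0.
have D1 : 0 < D + 1 by lra.
have Ne3 : 0 < 2 + 3 * Ne by lra.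
(* [eps1] serves the final estimate, where the errors add up to [eps * (2 + 3 * Ne) + delta / 2];
   [eps2] brings the partial sums of [a] below [eta']; [eps3] brings its coefficients below
   [delta]. *)
pose eps1 := delta / (2 * (2 + 3 * Ne)).
pose eps2 := `|s| * eta' / (D + 1).
pose eps3 := `|s| * delta / (2 * (D + 1)).
pose eps := Num.min eps1 (Num.min eps2 eps3).
have eps_gt0 : 0 < eps by rewrite !lt_min !divr_gt0 // mulr_gt0.
have eps_le1 : eps * (2 + 3 * Ne) <= delta / 2.
  have -> : delta / 2 = eps1 * (2 + 3 * Ne) by rewrite /eps1; field; rewrite gt_eqF.
  by rewrite ler_wpM2r ?(ltW Ne3) // ge_min lexx.
have eps_le2 : (D + 1) * eps <= `|s| * eta'.
  by rewrite mulrC -ler_pdivlMr // !ge_min lexx orbT.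
have eps_le3 : (D + 1) * eps <= `|s| * delta / 2.
  have -> : `|s| * delta / 2 = (D + 1) * eps3 by rewrite /eps3; field; rewrite gt_eqF.
  by rewrite ler_wpM2l ?(ltW D1) // !ge_min lexx !orbT.
exists eps; split => // b C n a b_inc b0 hs a1 hx.
pose x := block e b C; pose sx := block_sum b C; pose y := centered_block e b C.
have mass m : (m <= n)%N -> \sum_(r < m) `|a r * (sx r - s)| <= eps.
  move=> mn; apply: (@le_trans _ _ (\sum_(r < n) `|a r| * eps)); last first.
    by rewrite -mulr_suml a1 mul1r.
  rewrite (big_ord_widen n (fun r => `|a r * (sx r - s)|) mn) big_mkcond /=.
  apply: ler_sum => r _; case: ifP => _; last by rewrite mulr_ge0 // ltW.
  rewrite normrM; have [->|ar] := eqVneq (a r) 0; first by rewrite normr0 !mul0r.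
  by rewrite ler_wpM2l // hs.
(* Needed twice: without signs for [a] and with the signs that turn [a] into its absolute values. *)
have err (t : nat -> bool) :
    N (\sum_(r < n) ((-1) ^+ t r * (a r * (sx r - s))) *: e (b r)) <= eps * Ne.
  apply: le_trans (lincomb_le_mass N_add N_scale e_spreading n b
    (fun r => (-1) ^+ t r * (a r * (sx r - s)))) _.
  rewrite ler_wpM2r //; under eq_bigr do rewrite sign_mul_norm.
  exact: mass.
have partial m : (m <= n)%N -> `|s| * `|\sum_(r < m) a r| <= (D + 1) * eps.
  move=> mn; rewrite -normrM mulr_sumr.
  have -> : \sum_(r < m) s * a r
      = \sum_(r < m) a r * sx r - \sum_(r < m) a r * (sx r - s).
    by rewrite -sumrB; apply: eq_bigr => r _; ring.
  apply: le_trans (ler_normB _ _) _; rewrite mulrDl mul1r; apply: lerD.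
    apply: le_trans (block_partial_sums C b_inc b0 a hD mn) _.
    by rewrite ler_pM2l.
  by apply: le_trans (ler_norm_sum _ _ _) (mass m mn).
have small_a r : (r < n)%N -> `|a r| <= delta.
  move=> rn; rewrite -(ler_pM2l s0).
  have := partial _ rn; have := partial _ (ltnW rn); rewrite big_ord_recr /=.
  have := ler_normB (\sum_(i < r) a i + a r) (\sum_(i < r) a i).
  rewrite addrAC subrr add0r => /(ler_wpM2l (ltW s0)); rewrite mulrDr.
  move: eps_le3; lra.
have small_e : N (\sum_(r < n) a r *: e (b r)) <= eta.
  rewrite (spread_below e_spreading) //; last exact: strictly_increasing_below.
  apply: hOmega => // m mn; rewrite -(ler_pM2l s0).
  exact: le_trans (partial m mn) eps_le2.
have s_eta : `|s| * eta = delta / 4.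
  by rewrite /eta; field; rewrite gt_eqF.
have small_y : N (lincomb y n a) <= eps + delta / 4 + eps * Ne.
  have -> : lincomb y n a = lincomb x n a - s *: (\sum_(r < n) a r *: e (b r))
      - \sum_(r < n) ((-1) ^+ false * (a r * (sx r - s))) *: e (b r).
    rewrite scaler_sumr /lincomb -!sumrB; apply: eq_bigr => r _.
    rewrite expr0 mul1r /y /centered_block -/(sx r) scalerBr !scalerA -addrA -opprD.
    by rewrite -scalerDl; congr (_ - _ *: _); ring.
  apply: le_trans (seminormB N_add N_scale _ _) (lerD _ _).
    apply: le_trans (seminormB N_add N_scale _ _) (lerD hx _).
    by rewrite N_scale -s_eta ler_wpM2l.
  exact: (err (fun=> false)).
split => //.
have -> : \sum_(r < n) `|a r| *: (block e b C r - s *: e (b r))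
    = lincomb y n (fun r => (-1) ^+ (a r < 0)%R * a r)
      + \sum_(r < n) ((-1) ^+ (a r < 0)%R * (a r * (sx r - s))) *: e (b r).
  rewrite /lincomb -big_split; apply: eq_bigr => r _ /=.
  rewrite [(-1) ^+ _ * (a r * _)]mulrA -normrEsign -scalerA -scalerDr.
  congr (_ *: _); rewrite /y /centered_block -/(sx r) scalerBl.
  by rewrite addrA subrK.
apply: le_trans (N_add _ _) _.
have := centered_block_sign N_equiv e_spreading C b_inc b0 n a (fun r => a r < 0).
have := err (fun r => a r < 0).
rewrite -/y; lra.
Qed.

End Steps.

(** * Assembly of the convex block sequence *)

Lemma convex_block_seq_subsequence (R : realType) (X : normedModType R)
    (x : nat -> X) (phi J : nat -> nat) (lam : nat -> R) :
  strictly_increasing phi -> strictly_increasing J ->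
  (forall l, 0 <= lam l) -> (forall k, \sum_(J k <= l < J k.+1) lam l = 1) ->
  convex_block_seq x (fun k => \sum_(J k <= l < J k.+1) lam l *: x (phi l)).
Proof.
move=> phi_inc J_inc lam0 lam1.
have phi_lt k l : (phi k < phi l)%N = (k < l)%N.
  apply/idP/idP => [|/phi_inc //]; rewrite !ltnNge; apply: contra.
  exact: leq_strictly_increasing.
have phi_inj : injective phi.
  move=> k l kl; have := phi_lt k l; have := phi_lt l k; rewrite kl ltnn; lia.
(* Coefficients in [convex_block_seq] are indexed by the terms of [x], so the weights are carried
   over by a left inverse of [phi], with an arbitrary value 0 off its range. *)
have /choice[inv inv_phi] i : exists j, forall j', phi j' = i -> j = j'.
  have [[j <-]|hno] := pselect (exists j, phi j = i).
    by exists j => j' /phi_inj.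
  by exists 0%N => j' hj; case: hno; exists j'.
have invK j : inv (phi j) = j by apply: inv_phi.
pose F k := [fset phi l | l in index_iota (J k) (J k.+1)]%fset.
have sumF (V : nmodType) (G : nat -> V) k :
    \sum_(i <- F k) G i = \sum_(J k <= l < J k.+1) G (phi l).
  rewrite -(big_map phi xpredT G); apply: perm_big; apply: uniq_perm.
  - exact: fset_uniq.
  - by rewrite map_inj_uniq // iota_uniq.
  - move=> i; apply/idP/mapP => [/imfsetP[l /= hl ->]|[l hl ->]]; first by exists l.
    by apply/imfsetP; exists l.
exists F, (lam \o inv); split.
- move=> k l i j kl /imfsetP[p /= hp ->] /imfsetP[q /= hq ->]; apply: phi_inc.
  move: hp hq; rewrite !mem_index_iota => /andP[_ h1] /andP[h2 _].
  exact: leq_trans h1 (leq_trans (leq_strictly_increasing J_inc kl) h2).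
- move=> k; split=> [i _||]; first exact: lam0.
  + by rewrite sumF -[RHS](lam1 k); apply: eq_bigr => l _; rewrite /= invK.
  + by rewrite sumF; apply: eq_bigr => l _; rewrite /= invK.
Qed.

(** Each block starts where the previous one ends. The weights chosen for different blocks are glued
    into one sequence, which is harmless because [P] only sees the weights of its own interval. *)
Lemma choose_blocks (R : realType) (P : nat -> nat -> nat -> (nat -> R) -> Prop) :
  (forall k J, exists n lam, (J < n)%N /\ P k J n lam) ->
  (forall k J n lam lam', (forall l, (J <= l < n)%N -> lam l = lam' l) ->
    P k J n lam -> P k J n lam') ->
  exists (J : nat -> nat) (lam : nat -> R), [/\ strictly_increasing J,
    J 0%N = 0%N & forall k, P k (J k) (J k.+1) lam].
Proof.
move=> hP P_ext.
have /choice[f hf] (p : nat * nat) : exists q : nat * (nat -> R),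
    (p.2 < q.1)%N /\ P p.1 p.2 q.1 q.2.
  by have [n [lam h]] := hP p.1 p.2; exists (n, lam).
pose J := fix J k := if k is k'.+1 then (f (k', J k')).1 else 0%N.
have J_inc : strictly_increasing J.
  apply: homo_ltn => [? ? ?|k]; first exact: ltn_trans.
  by have [] := hf (k, J k).
have [rho rhoP] := label_exists J_inc (erefl 0%N).
exists J, (fun l => (f (rho l, J (rho l))).2 l); split=> // k.
have [_ /=] := hf (k, J k); apply: P_ext => l hl.
by rewrite (label_uniq J_inc rhoP hl).
Qed.

Theorem proposition3 (R : realType) (X Z : completeNormedModType R)
  (e : nat -> X) (z : nat -> Z)
  (he : conditional_spreading_basis e)
  (hz : convex_block_homogeneous_part e z)
  (x : nat -> X) (hblock : block_seq e x) (hx : seminormalized x) :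
  (exists phi : nat -> nat,
     strictly_increasing phi /\ unconditional (x \o phi)) \/
  (exists w : nat -> X, convex_block_seq x w /\ equivalent_seq w z).
Proof.
have [e_schauder _ e_cond] := he.
have [N [N_equiv e_spread _ z_limit]] := hz.
have [F [c [F_succ xE]]] := hblock.
have [cx [Cx [cx0 hxb]]] := hx.
have [N_add N_scale [c1 [C1 [c1_gt0 C1_gt0 hN]]]] := N_equiv.
have N_ge0 v : 0 <= N v by apply: seminorm_ge0.
have F_ne k : exists i, i \in F k.
  have [Fk|[i iF]] := fset_0Vmem (F k); last by exists i.
  have /andP[] := hxb k; rewrite xE Fk big_seq_fset0 normr0 => h.
  by have := lt_le_trans cx0 h; rewrite ltxx.
have x_ge k : c1 * cx <= N (x k).
  have /andP[h1 _] := hN (x k); apply: le_trans h1.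
  by rewrite ler_pM2l //; have /andP[] := hxb k.
have x_le k : N (x k) <= C1 * Cx.
  have /andP[_ h1] := hN (x k); apply: le_trans h1 _.
  by rewrite ler_pM2l //; have /andP[] := hxb k.
have Ne_gt0 : 0 < N (e 0%N) by apply: (basis_norm_gt0 N_equiv).
pose s k := \sum_(i <- F k) c i.
have sub (phi : nat -> nat) : strictly_increasing phi ->
    exists b C, [/\ strictly_increasing b, b 0%N = 0%N, x \o phi = block e b C
      & forall r, block_sum b C r = s (phi r)].
  move=> phi_inc.
  have [|b [C [b_inc b0 sumE]]] := @block_normal_form R (F \o phi) c _ (fun k => F_ne (phi k)).
    by move=> k l i j /phi_inc; apply: F_succ.
  exists b, C; split=> // [|r].
    by apply/funext => r; rewrite /= xE /block -sumE.
  have := sumE r R^o (fun=> 1); rewrite /s /block_sum /=.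
  under eq_bigr do rewrite [_ *: _]mulr1.
  by under [in RHS]eq_bigr do rewrite [_ *: _]mulr1.
have [D [D0 hD]] := partial_sums_bounded N_equiv e_spread e_schauder e_cond.
(* The block sum is read off by applying the partial sum bound to a single block. *)
have s_le k : `|s k| <= D * (C1 * Cx).
  have [b [C [b_inc b0 xb sb]]] := sub id (fun _ _ => id).
  have := block_partial_sums C b_inc b0 (fun r => (r == k)%:R) hD (leqnn k.+1).
  have -> : \sum_(r < k.+1) (r == k :> nat)%:R * block_sum b C r = s k.
    rewrite big_ord_recr /= eqxx mul1r big1 ?add0r // => r _.
    by rewrite ltn_eqF // mul0r.
  have -> : lincomb (block e b C) k.+1 (fun r => (r == k)%:R) = x k.
    rewrite lincombS /= eqxx scale1r -xb /= /lincomb big1 ?add0r // => r _.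
    by rewrite ltn_eqF // scale0r.
  by move=> h; apply: le_trans h _; rewrite ler_pM2l.
have [l hl] := bounded_cluster s_le.
have [l0|l0] := eqVneq l 0.
  (* With geometric decay, this makes the total perturbation at most a quarter of the lower bound
     [c1 * cx]. *)
  left; pose u := c1 * cx / 4 / N (e 0%N).
  have u0 : 0 < u by rewrite !divr_gt0 ?mulr_gt0.
  have u_gt0 k : 0 < u * 2^-1 ^+ k.+1 by rewrite mulr_gt0 ?exprn_gt0 ?invr_gt0.
  have [phi [phi_inc hphi]] := fast_subsequence u_gt0 hl.
  exists phi; split=> //.
  have [b [C [b_inc b0 xb sb]]] := sub phi phi_inc.
  rewrite xb; apply: (small_sums_unconditional N_equiv e_spread b_inc b0
    (mulr_gt0 c1_gt0 cx0)) => [k|n].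
    by rewrite -xb x_ge.
  apply: (@le_trans _ _ (\sum_(r < n) (u * 2^-1 ^+ r.+1) * N (e 0%N))).
    apply: ler_sum => r _; rewrite ler_wpM2r // sb.
    by have := hphi r; rewrite l0 subr0.
  rewrite -mulr_suml -mulr_sumr mulrAC divfK ?gt_eqF // ler_piMr //.
    by rewrite ltW // divr_gt0 // mulr_gt0.
  exact: geometric_sum_le.
have [|hno] := pselect (exists phi : nat -> nat,
  strictly_increasing phi /\ unconditional (x \o phi)); first by left.
right; rewrite -normr_gt0 in l0.
have inv_gt0 k : 0 < k.+1%:R^-1 :> R by rewrite invr_gt0.
have [phi [phi_inc hphi]] := fast_subsequence inv_gt0 hl.
have [b [C [b_inc b0 xb sb]]] := sub phi phi_inc.
have hno' : ~ (exists psi : nat -> nat,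
    strictly_increasing psi /\ unconditional (block e b C \o psi)).
  move=> [psi [psi_inc h]]; apply: hno; exists (phi \o psi); split.
    by move=> i j /psi_inc /phi_inc.
  by rewrite compA xb.
(* The coefficients of a combination are at most [2 * D] times its norm in [Z], so these errors add
   up to at most a quarter of [|l|] times that norm. Dividing by [|l|] in [eta] gives the same bound
   once the blocks [g] are multiplied by [l]. *)
pose u k : R := `|l| / (8 * D) * 2^-1 ^+ k.+1.
have u_gt0 k : 0 < u k.
  by rewrite mulr_gt0 ?divr_gt0 ?mulr_gt0 ?exprn_gt0 ?invr_gt0.
pose eta k := u k / `|l|.
have eta_gt0 k : 0 < eta k by rewrite divr_gt0.
have /choice[K /choice[delta hKd]] k : exists (K : nat) delta,
    0 < delta /\ near_average N e K delta (eta k).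
  exact: (near_average_exists N_equiv e_spread e_schauder e_cond (eta_gt0 k)).
(* The bound [delta k] on the weights is for [near_average], the bound [u k] for the distance from
   [w k] to [l *: g k]. *)
pose dlt k := Num.min (delta k) (u k).
have dlt_gt0 k : 0 < dlt k by rewrite lt_min u_gt0 andbT; case: (hKd k).
pose P k J n (lam : nat -> R) := [/\ forall j, (J <= j < n)%N -> 0 <= lam j <= dlt k,
  \sum_(J <= j < n) lam j = 1 &
  N (\sum_(J <= j < n) lam j *: (block e b C j - l *: e (b j))) <= dlt k].
have step k J : exists n lam, (J < n)%N /\ P k J n lam.
  rewrite normr_gt0 in l0.
  have [eps [eps0 heps]] := nearly_null_step N_equiv e_spread e_schauder e_cond l0
    (dlt_gt0 k).
  have [J0 hJ0] := inv_natS_lt eps0.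
  have xb_ge r : c1 * cx <= N (block e b C r) by rewrite -xb x_ge.
  have xb_le r : N (block e b C r) <= C1 * Cx by rewrite -xb x_le.
  (* Starting past [J0] makes every block sum that occurs close to [l]; starting past [J] makes the
     blocks successive. *)
  have [n [a [Jn a0 a1 ha]]] := not_l1_tail N_equiv (maxn J J0)
    (mulr_gt0 c1_gt0 cx0) xb_ge xb_le hno' eps0.
  have hs r : (r < n)%N -> a r != 0 -> `|block_sum b C r - l| <= eps.
    move=> _ ar; rewrite sb; apply: le_trans (hphi r) (ltW (hJ0 r _)).
    rewrite leqNgt; apply: contra ar => h; rewrite a0 //.
    by rewrite (leq_trans h) // leq_maxr.
  have [h1 h2] := heps b C n a b_inc b0 hs a1 ha.
  have JJ : (J < n)%N by apply: leq_ltn_trans Jn; apply: leq_maxl.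
  have tail (V : nmodType) (G : nat -> V) : (forall j, a j = 0 -> G j = 0) ->
      \sum_(J <= j < n) G j = \sum_(j < n) G j.
    move=> hG; rewrite -(big_mkord xpredT G) [RHS](@big_cat_nat _ _ _ J) //=; last first.
      exact: ltnW.
    rewrite [X in _ = X + _]big_nat [X in _ = X + _]big1 ?add0r // => j /andP[_ jJ].
    by apply: hG; apply: a0; apply: leq_trans jJ (leq_maxl _ _).
  exists n, (fun j => `|a j|); split=> //; split.
  - by move=> j /andP[_ jn]; rewrite normr_ge0 h1.
  - by rewrite tail // => j ->; rewrite normr0.
  - by rewrite tail // => j ->; rewrite normr0 scale0r.
have P_ext k J n lam lam' : (forall j, (J <= j < n)%N -> lam j = lam' j) ->
    P k J n lam -> P k J n lam'.
  move=> h [h1 h2 h3]; split.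
  - by move=> j hj; rewrite -h // h1.
  - by rewrite -h2; apply: eq_big_nat => j hj; rewrite h.
  - move: h3; congr (N _ <= _); apply: eq_big_nat => j hj; rewrite h //.
have [J [lam0 [J_inc J0 hlam0]]] := choose_blocks step P_ext.
have [rho rhoP] := label_exists J_inc J0.
have lam_bounds j : 0 <= lam0 j <= dlt (rho j).
  by have [h _ _] := hlam0 (rho j); apply: h.
have lam_ge0 j : 0 <= lam0 j by case/andP: (lam_bounds j).
have lam_sum k : \sum_(J k <= j < J k.+1) lam0 j = 1 by case: (hlam0 k).
have lam_le r j : (J r <= j < J r.+1)%N -> lam0 j <= delta r.
  move=> hj; have /andP[_] := lam_bounds j; rewrite (label_uniq J_inc rhoP hj).
  by move=> h; apply: le_trans h _; rewrite ge_min lexx.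
pose w k := \sum_(J k <= j < J k.+1) lam0 j *: x (phi j).
exists w; split; first exact: convex_block_seq_subsequence.
pose g k := \sum_(J k <= j < J k.+1) lam0 j *: e (b j).
have w_g k : N (w k - l *: g k) <= u k.
  have [_ _ h] := hlam0 k; apply: le_trans (_ : dlt k <= _); last first.
    by rewrite ge_min lexx orbT.
  move: h; congr (N _ <= _); rewrite /w /g scaler_sumr -sumrB.
  apply: eq_bigr => j _; rewrite -xb /= scalerBr.
  by rewrite !scalerA [l * _]mulrC.
(* Two errors of at most [|l| / 4] times the norm in [Z] are added: from [w] to [l *: g], and from
   [g] to [z]. *)
have main n (a : nat -> R) :
    `|N (lincomb w n a) - `|l| * `|lincomb z n a| | <= `|l| / 2 * `|lincomb z n a|.
  set L := `|lincomb z n a|.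
  have coef r : (r < n)%N -> `|a r| <= 2 * D * L.
    by move=> rn; apply: (homogeneous_coef z_limit D0 hD).
  have h1 : `|N (lincomb g n a) - L| <= \sum_(r < n) `|a r| * eta r.
    exact: (homogeneous_compare N_equiv e_spread z_limit n a J_inc J0 b_inc lam_ge0
      lam_sum (fun r => (hKd r).2) (fun r => (hKd r).1) lam_le).
  have h2 : N (lincomb w n a - l *: lincomb g n a) <= \sum_(r < n) `|a r| * u r.
    rewrite /lincomb scaler_sumr -sumrB.
    apply: le_trans (seminorm_sum N_add N_scale _ _ _) _; apply: ler_sum => r _.
    by rewrite scalerA [l * _]mulrC -scalerA -scalerBr N_scale ler_wpM2l.
  have h3 : `|l| * \sum_(r < n) `|a r| * eta r = \sum_(r < n) `|a r| * u r.
    rewrite mulr_sumr; apply: eq_bigr => r _; rewrite /eta; field.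
    by rewrite gt_eqF.
  have h4 : \sum_(r < n) `|a r| * u r <= `|l| / 4 * L.
    apply: (@le_trans _ _ (\sum_(r < n) (2 * D * L) * u r)).
      by apply: ler_sum => r _; rewrite ler_wpM2r ?coef // ltW.
    rewrite -mulr_sumr /u -mulr_sumr.
    have -> : 2 * D * L * (`|l| / (8 * D) * \sum_(k < n) 2^-1 ^+ k.+1)
        = `|l| / 4 * L * \sum_(k < n) 2^-1 ^+ k.+1.
      by field; rewrite gt_eqF.
    have L0 : 0 <= `|l| / 4 * L by apply: mulr_ge0; [exact: divr_ge0 | exact: normr_ge0].
    exact: ler_piMr L0 (geometric_sum_le R n).
  have h5 : `| `|l| * N (lincomb g n a) - `|l| * L| <= \sum_(r < n) `|a r| * u r.
    by rewrite -mulrBr normrM normr_id -h3 ler_wpM2l.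
  have h6 := seminorm_le_dist N_add (lincomb w n a) (l *: lincomb g n a).
  have h7 := seminorm_le_dist N_add (l *: lincomb g n a) (lincomb w n a).
  rewrite (seminorm_distC N_scale) N_scale in h7; rewrite N_scale in h6.
  rewrite ler_norml in h5; case/andP: h5 => h5 h5'.
  rewrite ler_norml; apply/andP; split; lra.
(* By [main], the [N]-norm lies between [1 / 2] and [3 / 2] of [|l|] times the norm in [Z]; [c1] and
   [C1] translate it into the original norm. *)
exists (2 * c1 / (3 * `|l|)), (2 * C1 / `|l|); split.
- by rewrite divr_gt0 ?mulr_gt0.
- by rewrite divr_gt0 ?mulr_gt0.
move=> n a; have := main n a; rewrite ler_norml => /andP[h1 h2].
have /andP[h3 h4] := hN (lincomb w n a).
apply/andP; split.
- rewrite mulrAC ler_pdivrMr ?mulr_gt0 // -mulrA; lra.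
- rewrite mulrAC ler_pdivlMr // -mulrA; lra.
Qed.
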